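(* Consider the TSP instance $G_1$ on $V=\{1,\dots,n\}$ with $d(\{i,i+1\})=1$ for $i=1,\dots,n-1$, $d(\{n,1\})=1$, and $d(e)=n$ for all other edges; its unique optimal Hamiltonian cycle is $s^*=(1,2,\dots,n)$. Run the cross-entropy algorithm described in the context (with $M=1$, $\rho=1$, $\pi_{\min}=\frac{1}{n(n-2)}$, $\pi_{\max}=1-\frac1n$) with the edge-based random solution generation and a sample size $N<\frac{1}{220}\ln n$. Then, with probability $1-e^{-\Omega(n^{1/200})}$ (as $n\to\infty$), the algorithm does not find $s^*$ within $e^{\Theta(n^{1/300})}$ iterations.
   Context: Let $K_n$ be the complete graph on $V=\{1,\dots,n\}$. A feasible solution is a Hamiltonian cycle; its cost is the sum of $d$ over its edges. For a Hamiltonian cycle $H$, let $\Pi^H=(\pi_{i,j})$ be the symmetric matrix with $\pi_{i,i}=0$, $\pi_{i,j}=1-\frac1n$ if $\{i,j\}\in H$ and $\pi_{i,j}=\frac{1}{n(n-2)}$ otherwise. Edge-based generation from $\Pi$: starting from $B=\emptyset$, repeatedly add an edge $\{i,j\}\notin B$ chosen among admissible edges with probability proportional to $\pi_{i,j}+\pi_{j,i}$ until $B$ is a Hamiltonian cycle; an edge is admissible if adding it to $B$ creates no vertex of degree $\ge3$ and no cycle with fewer than $n$ edges. The algorithm: $\Pi_0$ has all off-diagonal entries $\frac1{n-1}$; in iteration $t=0,1,\dots$ generate $N$ independent solutions from $\Pi_t$, let $X_t^{[1]}$ be one of minimum cost, and set $\Pi_{t+1}=\Pi^{X_t^{[1]}}$.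 The optimal solution is found within $T$ iterations if some $X_t^{[1]}$, $t\le T$, is optimal. *)

(* Defs.v *)
From HB Require Import structures.
From mathcomp Require Import all_boot all_order all_algebra.
From mathcomp Require Import reals sequences exp.
Set Implicit Arguments. Unset Strict Implicit. Unset Printing Implicit Defensive.
Import Order.TTheory GRing.Theory Num.Theory.
Local Open Scope ring_scope.

(* Vertices: 'I_n (vertex k+1 of the paper is the ordinal k).
   Undirected edge {i,j} (i <> j) is represented canonically by the pair
   (min, max); an edge set is a {set 'I_n * 'I_n}. *)
Definition mkedge n (i j : 'I_n) : 'I_n * 'I_n :=
  if (i < j)%N then (i, j) else (j, i).

Definition adj n (B : {set 'I_n * 'I_n}) (i j : 'I_n) : bool :=
  (i != j) && (mkedge i j \in B).

Definition has_cycle_len n (B : {set 'I_n * 'I_n}) (k : nat) : bool :=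
  [exists f : {ffun 'I_k -> 'I_n},
     [&& (3 <= k)%N, injectiveb f & [forall i : 'I_k, adj B (f i) (f (ordS i))]]].

Definition has_short_cycle n (B : {set 'I_n * 'I_n}) : bool :=
  [exists k : 'I_n, has_cycle_len B k].

Definition is_ham n (B : {set 'I_n * 'I_n}) : bool :=
  (3 <= n)%N &&
  [exists f : {ffun 'I_n -> 'I_n},
     injectiveb f && (B == [set mkedge (f i) (f (ordS i)) | i : 'I_n])].

Definition deg n (B : {set 'I_n * 'I_n}) (v : 'I_n) : nat :=
  #|[set e in B | (e.1 == v) || (e.2 == v)]|.

Definition admissible n (B : {set 'I_n * 'I_n}) (e : 'I_n * 'I_n) : bool :=
  [&& (e.1 < e.2)%N, e \notin B,
      [forall v, (deg (e |: B) v <= 2)%N] & ~~ has_short_cycle (e |: B)].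

Definition ew (R : realType) n (pi : 'I_n -> 'I_n -> R) (e : 'I_n * 'I_n) : R :=
  pi e.1 e.2 + pi e.2 e.1.

Fixpoint genP (R : realType) n (pi : 'I_n -> 'I_n -> R) (k : nat)
    (B H : {set 'I_n * 'I_n}) {struct k} : R :=
  if is_ham B then (B == H)%:R else
  match k with
  | 0 => 0
  | k'.+1 =>
      \sum_(e | admissible B e)
        (ew pi e / \sum_(e' | admissible B e') ew pi e') * genP pi k' (e |: B) H
  end.

(* distribution of one solution generated from pi (starting from B = emptyset;
   n steps suffice since a Hamiltonian cycle has n edges) *)
Definition gen (R : realType) n (pi : 'I_n -> 'I_n -> R) (H : {set 'I_n * 'I_n}) : R :=
  genP pi n set0 H.

Definition Pi0 (R : realType) n : 'I_n -> 'I_n -> R :=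
  fun i j => if i == j then 0 else 1 / (n%:R - 1).

Definition PiH (R : realType) n (H : {set 'I_n * 'I_n}) : 'I_n -> 'I_n -> R :=
  fun i j => if i == j then 0
             else if mkedge i j \in H then 1 - 1 / n%:R
             else 1 / (n%:R * (n%:R - 2)).

Arguments Pi0 R n : clear implicits.
Arguments PiH R [n] H.

Definition d1 n (e : 'I_n * 'I_n) : nat :=
  if (e.2 == e.1.+1 :> nat) || ((e.1 == 0 :> nat) && (e.2 == n.-1 :> nat))
  then 1 else n.

Definition cost n (H : {set 'I_n * 'I_n}) : nat := \sum_(e in H) d1 e.

Definition sstar n : {set 'I_n * 'I_n} := [set mkedge i (ordS i) | i : 'I_n].

(* sel t s : the sample X_t^[1] chosen among the N samples s of iteration t;
   it must be one of minimum cost (arbitrary tie-breaking) *)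
Definition best_selector n N
    (sel : nat -> N.-tuple {set 'I_n * 'I_n} -> {set 'I_n * 'I_n}) : Prop :=
  forall t s, sel t s \in s /\ forall x, x \in s -> (cost (sel t s) <= cost x)%N.

Definition kernel (R : realType) n N
    (sel : nat -> N.-tuple {set 'I_n * 'I_n} -> {set 'I_n * 'I_n})
    (t : nat) (pi : 'I_n -> 'I_n -> R) (H : {set 'I_n * 'I_n}) : R :=
  \sum_(s : N.-tuple {set 'I_n * 'I_n})
     (sel t s == H)%:R * \prod_(x <- s) gen pi x.

(* avoid sel k t pi : probability that X_t^[1], ..., X_{t+k}^[1] all differ
   from s*, given Pi_t = pi *)
Fixpoint avoid (R : realType) n N
    (sel : nat -> N.-tuple {set 'I_n * 'I_n} -> {set 'I_n * 'I_n})
    (k t : nat) (pi : 'I_n -> 'I_n -> R) {struct k} : R :=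
  match k with
  | 0 => \sum_(H | H != sstar n) kernel sel t pi H
  | k'.+1 => \sum_(H | H != sstar n) kernel sel t pi H * avoid sel k' t.+1 (PiH R H)
  end.

(* probability that the algorithm does NOT find s* within T iterations
   (i.e. X_t^[1] <> s* for all t = 0..T) *)
Definition prob_not_found (R : realType) n N
    (sel : nat -> N.-tuple {set 'I_n * 'I_n} -> {set 'I_n * 'I_n}) (T : nat) : R :=
  avoid sel T 0 (Pi0 R n).
Arguments prob_not_found R [n N] sel T.

(* Main.v *)
Require Import Defs.
From HB Require Import structures.
From mathcomp Require Import all_boot all_order all_algebra all_fingroup.
From mathcomp Require Import reals sequences exp.
From mathcomp Require Import zify ring lra.
Set Implicit Arguments. Unset Strict Implicit. Unset Printing Implicit Defensive.
Import Order.TTheory GRing.Theory Num.Theory.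

(** Let k be the number of edges of s* missing from the current best tour H, and
    use the potential b^(-min(k,K)) with b slightly larger than 1 and K about
    n^(1/5).

    A tour sampled from Pi^H contains Z edges outside H, where Z has a bounded
    exponential moment: while m paths remain, a non-H edge is picked with
    probability O(1/n), unless m is already O(number of non-H edges picked), and
    then at most m more can follow.  Since Pi^H is invariant under rotating H,
    every edge of H is lost with the same probability E[Z]/n.  Gaining an edge of
    s* requires losing one of at most 2k given edges of H, so it has probability
    O(k/n).  On the other hand, with constant probability one of the first n/2
    picks is a non-H edge at a vertex whose two H-edges lie in s*, and then an
    edge of s* is lost.  With N < ln n / 220 samples, all of them lose an edge
    with probability at least n^(-1/10), which outweighs the gains as long as
    k < K.  So the expected potential grows by at most O(N b^(-K)) per iteration,
    while s* itself has potential 1. *)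

(** * Linear forests and Hamiltonian cycles *)

Section Graph.
Variable n : nat.
Local Notation V := 'I_n.
Local Notation edges := {set V * V}.
Implicit Types (B : edges) (e : V * V) (u v x y : V) (c : V -> V).

(** A small probability of gaining an edge does not by itself control the potential, since one
    sample may gain many edges at once; hence the exponential moment of Z. On the rare event of a
    gain, x = b^Z is split by x <= a x^2 + 1/(4a), so the moment is needed at b^2.

    The cap K makes the gain probability small and keeps 4K^2 <= n, which leaves most vertices with
    both their H-edges in s*; beyond the cap the potential is so small that a crude bound suffices.

    The selected sample is treated as arbitrary: it is certain to lose an edge only if all N samples
    do. Each does so with probability at least 1/100, independently, and 100^N <= e^(22N) < n^(1/10)
    explains the constant 1/220. With y = n^(1/10), gains cost O(y^-2) per iteration against y^-1/21
    from losses, and b^-K is below e^(-(y^2-1)/21), which beats e^y iterations. *)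

Definition inc e v := (e.1 == v) || (e.2 == v).
Definition ordered B := forall e, e \in B -> (e.1 < e.2)%N.
Definition nb B v := [set y | adj B v y].

Lemma mkedgeC x y : mkedge x y = mkedge y x.
Proof.
by rewrite /mkedge; case: (ltngtP x y) => // /val_inj ->.
Qed.

Lemma mkedge_lt x y : x != y -> ((mkedge x y).1 < (mkedge x y).2)%N.
Proof. by rewrite /mkedge -val_eqE /= neq_ltn; case: ifP => //=. Qed.

Lemma mkedge_ord e : (e.1 < e.2)%N -> mkedge e.1 e.2 = e.
Proof. by rewrite /mkedge => ->; case: e. Qed.

Lemma inc_mkedge x y v : inc (mkedge x y) v = (x == v) || (y == v).
Proof. by rewrite /inc /mkedge; case: ifP => //= _; rewrite orbC. Qed.

Lemma mkedge_inj x y z : mkedge x y = mkedge x z -> y = z.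
Proof.
rewrite /mkedge; case: (ltnP x y) => h1; case: (ltnP x z) => h2 [] => //.
  by move=> h3 h4; move: h1; rewrite h4 ltnn.
by move=> h3 h4; move: h2; rewrite -h4 ltnn.
Qed.

Lemma mkedge_eq x y z t : mkedge x y = mkedge z t ->
  (x = z /\ y = t) \/ (x = t /\ y = z).
Proof. by rewrite /mkedge; do 2 case: ifP => //; move=> h1 h2 [-> ->]; auto. Qed.

Lemma adjC B x y : adj B x y = adj B y x.
Proof. by rewrite /adj eq_sym mkedgeC. Qed.

Lemma adj_sub B B' x y : B \subset B' -> adj B x y -> adj B' x y.
Proof. by move=> /subsetP s /andP[h1 /s h2]; rewrite /adj h1. Qed.

Lemma connect_adjC B : connect_sym (adj B).
Proof. by apply: sym_connect_sym => x y; rewrite adjC. Qed.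

Lemma adj_add B e x y : (e.1 < e.2)%N -> adj (e |: B) x y =
  [|| adj B x y, (x == e.1) && (y == e.2) | (x == e.2) && (y == e.1)].
Proof.
move=> lt; rewrite /adj in_setU1; have [->|nxy] /= := eqVneq x y.
  apply/esym/negbTE; rewrite negb_or; apply/andP; split.
    by apply/negP => /andP[/eqP h1 /eqP h2]; move: lt; rewrite -h1 -h2 ltnn.
  by apply/negP => /andP[/eqP h1 /eqP h2]; move: lt; rewrite -h1 -h2 ltnn.
rewrite orbC; congr orb; rewrite -{1}(mkedge_ord lt).
apply/eqP/idP; first by move/mkedge_eq => [[-> ->]|[-> ->]]; rewrite !eqxx ?orbT.
by case/orP=> /andP[/eqP -> /eqP ->] //; rewrite mkedgeC.
Qed.

Lemma degE B v : deg B v = \sum_(e in B) inc e v.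
Proof.
rewrite /deg -sum1_card big_mkcond [RHS]big_mkcond; apply: eq_bigr => e _.
by rewrite inE /inc; case: (e \in B); case: (_ || _).
Qed.

Lemma deg_add B e v : e \notin B -> deg (e |: B) v = inc e v + deg B v.
Proof. by move=> h; rewrite !degE big_setU1. Qed.

Lemma sum_deg B : ordered B -> \sum_v deg B v = #|B|.*2.
Proof.
move=> oB; under eq_bigr do rewrite degE.
rewrite exchange_big -addnn -sum1_card -big_split /=; apply: eq_bigr => e /oB lt.
have ne : e.1 != e.2 by rewrite -val_eqE neq_ltn lt.
rewrite (bigD1 e.1) // (bigD1 e.2) /=; last by rewrite eq_sym.
rewrite /inc !eqxx orbT big1 // => v /andP[h1 h2].
by rewrite eq_sym (negbTE h1) eq_sym (negbTE h2).
Qed.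

Lemma card_nb B v : #|nb B v| <= deg B v.
Proof.
rewrite -(card_imset (nb B v) (f := mkedge v)); last by move=> y z; exact: mkedge_inj.
apply: subset_leq_card; apply/subsetP => e /imsetP[y]; rewrite inE => /andP[_ h] ->.
by rewrite inE h -/(inc _ _) inc_mkedge eqxx.
Qed.

Lemma deg_gt0 B v y : adj B v y -> 0 < deg B v.
Proof. by move=> h; apply: leq_trans (card_nb B v); apply/card_gt0P; exists y; rewrite inE. Qed.

(** * Cycles in graphs of maximum degree 2 *)

Lemma ordS_neq k (i : 'I_k) : 2 <= k -> ordS i != i.
Proof.
move=> k2; rewrite -val_eqE /=; have := ltn_ord i.
rewrite leq_eqVlt => /orP[/eqP h|h]; first by rewrite h modnn -eqSS h; case: k k2 {i h} => [|[]].
by rewrite modn_small // neq_ltn ltnSn orbT.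
Qed.

Lemma ordSS_neq k (i : 'I_k) : 3 <= k -> ordS (ordS i) != i.
Proof.
move=> k3; rewrite -val_eqE /= -addn1 modnDml addn1; have := ltn_ord i.
rewrite leq_eqVlt => /orP[/eqP h|h].
  rewrite -[i.+2]/(i.+1.+1) h -(addn1 k) modnDl modn_small; last by apply: ltn_trans k3.
  by rewrite -eqSS h; apply: contraTneq k3 => <-.
move: h; rewrite leq_eqVlt => /orP[/eqP h|h].
  by rewrite h modnn -2!eqSS h; apply: contraTneq k3 => <-.
by rewrite modn_small //; lia.
Qed.

(** For [3 <= k] the two cyclic neighbours of a vertex are distinct and use up its degree, so no
    edge leaves the cycle. *)
Lemma cycle_nb B k (f : 'I_k -> V) : 3 <= k -> injective f ->
  (forall i, adj B (f i) (f (ordS i))) -> (forall v, deg B v <= 2) ->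
  forall i, deg B (f i) = 2 /\ forall y, adj B (f i) y -> exists j, y = f j.
Proof.
move=> k3 injf cyc d2 i; set p := ord_pred i.
have pi : ordS p = i by rewrite /p ord_predK.
have sub : [set f (ordS i); f p] \subset nb B (f i).
  apply/subsetP => y /set2P[]->; rewrite inE //.
  by have := cyc p; rewrite pi adjC.
have card2 : #|[set f (ordS i); f p]| = 2.
  by rewrite cards2 (inj_eq injf) -{1}pi ordSS_neq.
have degi : deg B (f i) = 2.
  by apply/eqP; rewrite eqn_leq d2 -card2 (leq_trans (subset_leq_card sub)) ?card_nb.
split=> // y ay; have : y \in nb B (f i) by rewrite inE.
have /eqP <- : [set f (ordS i); f p] == nb B (f i).
  by rewrite eqEcard sub card2 -degi card_nb.
by case/set2P => ->; eexists.
Qed.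

Lemma cycle_closed B k (f : 'I_k -> V) : 3 <= k -> injective f ->
  (forall i, adj B (f i) (f (ordS i))) -> (forall v, deg B v <= 2) ->
  forall i y, connect (adj B) (f i) y -> exists j, y = f j.
Proof.
move=> k3 injf cyc d2 i y /connectP[p pp ->].
elim: p i pp => [|z p IH] i /=; first by exists i.
by case/andP => /(proj2 (cycle_nb k3 injf cyc d2 i)) [j ->]; apply: IH.
Qed.

Lemma cycle_lenP B k : reflect
  (3 <= k /\ exists f : {ffun 'I_k -> V}, injective f /\ forall i, adj B (f i) (f (ordS i)))
  (has_cycle_len B k).
Proof.
apply: (iffP existsP) => [[f /and3P[h1 /injectiveP h2 /forallP h3]]|[h1 [f [h2 h3]]]].
  by split => //; exists f.
by exists f; apply/and3P; split=> //; [apply/injectiveP|apply/forallP].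
Qed.

Lemma path_cycle B x p : 2 <= size p -> path (adj B) x p -> uniq (x :: p) ->
  adj B (last x p) x -> has_cycle_len B (size p).+1.
Proof.
move=> sp pp up ax; apply/cycle_lenP; split => //.
exists [ffun i : 'I_(size p).+1 => nth x (x :: p) i]; split.
  move=> i j; rewrite !ffunE => /eqP; rewrite nth_uniq //=; exact: (fun h => val_inj (eqP h)).
move=> i; rewrite !ffunE /=; have := ltn_ord i; rewrite ltnS leq_eqVlt => /orP[/eqP h|h].
  by rewrite h modnn /= -[nth _ (x :: p) _]/(nth x (x :: p) (size p)) nth_last.
by rewrite modn_small ?ltnS //; apply: (pathP x pp).
Qed.

(* B is a disjoint union of m paths, c labelling the vertices by their path.
   A path, possibly reduced to one vertex, has total degree defect 2; this also
   excludes cycles, whose vertices have no defect. *)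
Record forest (m : nat) B c : Prop := Forest {
  fo_ord : ordered B;
  fo_deg : forall v, deg B v <= 2;
  fo_conn : forall x y, c x = c y -> connect (adj B) x y;
  fo_lab : forall x y, adj B x y -> c x = c y;
  fo_def : forall x, \sum_(y | c y == c x) (2 - deg B y) = 2;
  fo_card : #|[set c x | x in [set: V]]| = m }.

Lemma forest0 : forest n set0 id.
Proof.
have d0 v : deg (set0 : edges) v = 0 by rewrite degE big_set0.
split => //=.
- by move=> e; rewrite inE.
- by move=> v; rewrite d0.
- by move=> x y ->.
- by move=> x y /andP[_]; rewrite inE.
- by move=> x; rewrite big_pred1_eq d0.
- by rewrite imset_id cardsT card_ord.
Qed.

(** * Growing a forest of paths edge by edge *)

Section Forest.
Variables (m : nat) (B : edges) (c : V -> V) (F : forest m B c).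

Lemma forest_sum : \sum_y (2 - deg B y) = m.*2.
Proof.
rewrite (partition_big_imset c) /= -(fo_card F) -mul2n mulnC.
rewrite (eq_bigr (fun=> 2)); last by move=> l /imsetP[x _ ->]; exact: (fo_def F).
rewrite sum_nat_const; congr (#|pred_of_set _| * _).
by apply/setP => l; apply/imsetP/imsetP => [[x _ ->]|[x _ ->]]; exists x.
Qed.

(** Degrees sum to twice the number of edges, defects to [m.*2], and a degree and its defect add up
    to 2. *)
Lemma forest_card : #|B| + m = n.
Proof.
apply: double_inj; rewrite doubleD -(sum_deg (fo_ord F)) -forest_sum -big_split /=.
rewrite (eq_bigr (fun=> 2)); last by move=> v _; rewrite subnKC // (fo_deg F).
by rewrite sum_nat_const card_ord muln2.
Qed.

(** A cycle is a whole component and all its vertices have degree 2, so its total defect would be 0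
    instead of 2. *)
Lemma forest_acyclic k : ~~ has_cycle_len B k.
Proof.
apply/negP => /cycle_lenP[k3 [f [injf cyc]]].
have k0 : 0 < k by apply: leq_trans k3.
pose i0 := Ordinal k0; have := fo_def F (f i0).
rewrite big1 // => y /eqP /esym /(fo_conn F) /(cycle_closed k3 injf cyc (fo_deg F)) [j ->].
by rewrite (proj1 (cycle_nb k3 injf cyc (fo_deg F) j)).
Qed.

Lemma forest_rep x : exists2 y, c y = c x & deg B y < 2.
Proof.
have [y /andP[/eqP h1 h2]|h] := pickP [pred y | (c y == c x) && (deg B y < 2)].
  by exists y.
 have := fo_def F x; rewrite big1 // => y hy.
by have /= := h y; rewrite hy /= ltnNge => /negbFE h2; apply/eqP; rewrite subn_eq0.
Qed.

Lemma forest_const : m = 1 -> forall x y, c x = c y.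
Proof.
move=> m1 x y; have := fo_card F; rewrite m1 => /eqP/cards1P[l hl].
have inl z : c z = l by apply/set1P; rewrite -hl; apply: imset_f.
by rewrite !inl.
Qed.

Lemma forest_add e : (e.1 < e.2)%N -> c e.1 != c e.2 -> deg B e.1 < 2 -> deg B e.2 < 2 ->
  forest m.-1 (e |: B) (fun x => if c x == c e.2 then c e.1 else c x).
Proof.
move=> lt nc d1 d2; set c' := fun x => _.
have eB : e \notin B.
  apply/negP => eB; move/eqP: nc; apply; apply: (fo_lab F).
  by rewrite /adj (mkedge_ord lt) eB -val_eqE neq_ltn lt.
have ne : e.1 != e.2 by rewrite -val_eqE neq_ltn lt.
have sub x y : connect (adj B) x y -> connect (adj (e |: B)) x y.
  apply: connect_sub => {}x {}y h; apply: connect1; apply: adj_sub h; exact: subsetUr.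
have ce : connect (adj (e |: B)) e.1 e.2.
  by apply: connect1; rewrite adj_add // !eqxx orbT.
have cn x y : c x = c y -> connect (adj (e |: B)) x y.
  by move=> h; apply/sub/(fo_conn F).
have sym := @connect_adjC (e |: B).
have sD y : (2 - deg (e |: B) y) + inc e y = 2 - deg B y.
  rewrite deg_add // /inc; case: (eqVneq e.1 y) => [h1|n1]; case: (eqVneq e.2 y) => [h2|n2] /=.
  - by move: ne; rewrite h1 h2 eqxx.
  - by move: d1; rewrite h1; lia.
  - by move: d2; rewrite h2; lia.
  - by rewrite addn0.
split.
- by move=> e'; rewrite in_setU1 => /predU1P[->//|]; apply: (fo_ord F).
- move=> v; rewrite deg_add // /inc; case: (eqVneq e.1 v) => [<-//|n1]; case: (eqVneq e.2 v) => [<-//|n2].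
  exact: (fo_deg F).
- move=> x y; rewrite /c'; case: eqP => hx; case: eqP => hy.
  + by move=> _; apply: cn; rewrite hx hy.
  + move=> h; apply: (@connect_trans _ _ e.2); first exact: cn.
    by apply: (@connect_trans _ _ e.1); [rewrite sym|apply: cn].
  + move=> h; apply: (@connect_trans _ _ e.1); first exact: cn.
    by apply: (connect_trans ce); apply: cn.
  + exact: cn.
- move=> x y; rewrite adj_add // => /or3P[/(fo_lab F) h| |]; rewrite /c' ?h //.
    by case/andP => /eqP -> /eqP ->; rewrite eqxx; case: eqP.
  by case/andP => /eqP -> /eqP ->; rewrite eqxx; case: eqP.
- move=> x.
  have S1 : \sum_(y | c y == c e.1) inc e y = 1.
    rewrite (bigD1 e.1) //= /inc eqxx big1 // => y /andP[/eqP h1 h2].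
    rewrite eq_sym (negbTE h2) /=; apply/eqP; rewrite eqb0; apply/eqP => h3.
    by move: nc; rewrite h3 h1 eqxx.
  have S2 : \sum_(y | c y == c e.2) inc e y = 1.
    rewrite (bigD1 e.2) //= /inc eqxx orbT big1 // => y /andP[/eqP h1 h2].
    rewrite orbC eq_sym (negbTE h2) /=; apply/eqP; rewrite eqb0; apply/eqP => h3.
    by move: nc; rewrite h3 h1 eqxx.
  (* Each of the two merged components gives up one unit of defect to its end of [e]; the remaining
     1 and 1 add up to 2 for the union in [M]. *)
  have T z : \sum_(y | c y == c z) (2 - deg (e |: B) y) + \sum_(y | c y == c z) inc e y = 2.
    by rewrite -big_split /= (eq_bigr (fun y => 2 - deg B y)) ?(fo_def F).
  have := T e.1; rewrite S1 addn1 => -[T1]; have := T e.2; rewrite S2 addn1 => -[T2].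
  have M : \sum_(y | (c y == c e.1) || (c y == c e.2)) (2 - deg (e |: B) y) = 2.
    rewrite (bigID (fun y => c y == c e.1)) /=.
    rewrite (eq_bigl (fun y => c y == c e.1)); last by move=> y; rewrite andbC; case: (c y == c e.1).
    rewrite T1 (eq_bigl (fun y => c y == c e.2)) ?T2 // => y.
    by case: (eqVneq (c y) (c e.1)) => [->|_] /=; rewrite ?(negbTE nc) ?andbT.
  rewrite /c'; case: ifP => hx.
    rewrite -[RHS]M; apply: eq_bigl => y; case: ifP => h2; first by rewrite eqxx orbT.
    by rewrite orbF.
  have [h1|h1] := eqVneq (c x) (c e.1).
    rewrite -[RHS]M; apply: eq_bigl => y; case: ifP => h2; rewrite h1 ?eqxx ?orbT //.
    by rewrite orbF.
  have := T x; rewrite [X in _ + X]big1 ?addn0.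
    move=> Tx; rewrite -[RHS]Tx; apply: eq_bigl => y; case: ifP => h2 //.
    by rewrite (eqP h2) eq_sym (negbTE h1) eq_sym hx.
  move=> y /eqP hy; apply/eqP; rewrite eqb0 /inc negb_or; apply/andP; split; apply/eqP => h2.
    by move: h1; rewrite -hy h2 eqxx.
  by move: hx; rewrite -hy h2 eqxx.
- have -> : [set c' x | x in [set: V]] = [set c x | x in [set: V]] :\ c e.2.
    apply/setP => l; rewrite in_setD1; apply/imsetP/andP => [[x _ ->]|[hl /imsetP[x _ hx]]].
      rewrite /c'; case: ifP => h; first by split=> //; apply: imset_f.
      by rewrite h; split=> //; apply: imset_f.
    by exists x; rewrite // /c' -hx (negbTE hl).
  have := fo_card F; rewrite (cardsD1 (c e.2)) imset_f ?inE // add1n => <-; by [].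
Qed.

Lemma admissible_deg e : admissible B e -> deg B e.1 < 2 /\ deg B e.2 < 2.
Proof.
case/and4P => lt eB /forallP d _; have := d e.1; have := d e.2.
by rewrite !deg_add // /inc !eqxx orbT !add1n.
Qed.

(** The path between the ends of [e] closes up to a cycle. If that cycle has length n, the path
    visits every vertex, so [B] is already connected; this separates a forbidden short cycle from
    the closing edge of a tour. *)
Lemma connect_cycle e : (e.1 < e.2)%N -> e \notin B -> c e.1 = c e.2 ->
  exists2 k, has_cycle_len (e |: B) k & forall x, k = n -> connect (adj B) e.1 x.
Proof.
move=> lt eB /(fo_conn F)/connectP[p0 pp0 lp0].
case: (shortenP pp0) (lp0) => p pp up _ lp {p0 pp0 lp0}; exists (size p).+1.
  apply: path_cycle => //.
  - case: p lp pp {up} => [|z [|]] //=; first by move=> h; move: lt; rewrite h ltnn.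
    move=> <- /andP[/andP[_]]; by rewrite (mkedge_ord lt) (negbTE eB).
  - by apply: sub_path pp => x y; apply: adj_sub; apply: subsetUr.
  - by []. 
  - by rewrite -lp adj_add // !eqxx !orbT.
move=> x hk; have xin : x \in e.1 :: p.
  have := card_uniqP up; rewrite /= hk => h; apply: contraT => hx.
  have : #|x :: e.1 :: p| <= n by rewrite -[X in _ <= X]card_ord max_card.
  by rewrite (card_uniqP _) /= ?hk ?ltnn // inE; move: up hx; rewrite /= !inE => -> ->.
move: (xin); rewrite inE => /predU1P[->//|]; case/splitPl: xin pp {up lp hk} => p1 p2 lp1.
by rewrite cat_path => /andP[h _] _; apply/connectP; exists p1.
Qed.

(** An edge inside one component closes a cycle. A length below n is forbidden by admissibility, a
    length above n is impossible, and length n would make [B] a single path. *)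
Lemma admissible_cross e : 1 < m -> admissible B e -> c e.1 != c e.2.
Proof.
move=> m2 /and4P[lt eB _ /existsP hs]; apply/eqP => /(connect_cycle lt eB) [k hk hn].
have [kn|kn|kn] := ltngtP k n.
- by case: hs; exists (Ordinal kn).
- case/cycle_lenP: hk => _ [f [/leq_card]]; rewrite !card_ord => kn'.
  by move: kn; rewrite ltnNge kn'.
have all1 x : c x = c e.1.
  have /connectP[p pp ->] := hn x kn; elim: p e.1 pp {lt hk hn} => //= z p IH w.
  by case/andP => /(fo_lab F) -> /IH.
move: m2; rewrite -(fo_card F); suff -> : [set c x | x in [set: V]] = [set c e.1] by rewrite cards1.
by apply/setP => l; rewrite inE; apply/imsetP/eqP => [[x _ ->]|->]; [|exists e.1].
Qed.

End Forest.

Lemma cross_admissible m B c e : forest m B c -> (e.1 < e.2)%N -> c e.1 != c e.2 -> deg B e.1 < 2 -> deg B e.2 < 2 ->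
  admissible B e.
Proof.
move=> F lt nc d1 d2; have F' := forest_add F lt nc d1 d2; apply/and4P; split => //.
- apply/negP => eB; move/eqP: nc; apply; apply: (fo_lab F).
  by rewrite /adj (mkedge_ord lt) eB -val_eqE neq_ltn lt.
- apply/forallP; exact: fo_deg F'.
- by apply/existsP => -[k hk]; have := forest_acyclic F' k; rewrite hk.
Qed.

(* Cycles are closed under adjacency when degrees are at most 2. *)
Lemma forest1_cycle B c e k : forest 1 B c -> (forall v, deg (e |: B) v <= 2) ->
  has_cycle_len (e |: B) k -> k = n.
Proof.
move=> F d2 /cycle_lenP[k3 [f [injf cyc]]]; apply/eqP; rewrite eqn_leq.
have := leq_card f injf; rewrite !card_ord => -> /=.
have k0 : 0 < k by apply: leq_trans k3.
have sub : [set: V] \subset [set f i | i : 'I_k].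
  apply/subsetP => y _.
  have : connect (adj (e |: B)) (f (Ordinal k0)) y.
    have /(fo_conn F) := forest_const F erefl (f (Ordinal k0)) y.
    apply: connect_sub => x z h; apply: connect1; apply: adj_sub h; exact: subsetUr.
  by case/(cycle_closed k3 injf cyc d2) => j ->; apply: imset_f.
have := subset_leq_card sub; rewrite cardsT card_ord => /leq_trans; apply.
by apply: leq_trans (leq_imset_card _ _) _; rewrite card_ord.
Qed.

(** In a single spanning path all degrees are positive and the total defect is 2, so there are
    exactly two vertices of degree 1. They are not yet adjacent: otherwise they would form a
    component that misses a third vertex. *)
Lemma forest1_admissible B c : 2 < n -> forest 1 B c -> exists e, admissible B e.
Proof.
move=> n3 F.
have other x y : exists2 z, z != x & z != y.
  have : #|[set x; y]| < #|[set: V]|.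
    by rewrite cardsT card_ord cards2; apply: leq_ltn_trans n3; case: (_ != _).
  move/ltn_geF/negbT; case: (pickP [pred z | z \notin [set x; y]]) => [z /= h|h].
    by exists z; apply: contraNneq h => ->; rewrite !inE eqxx ?orbT.
  move/negP; case; apply: subset_leq_card; apply/subsetP => z _.
  by have /= := h z; move/negbFE.
have dpos x : 0 < deg B x.
  have [z zx _] := other x x; have /(fo_conn F) := forest_const F erefl x z.
  case/connectP => -[|w p] /= h e; first by rewrite e eqxx in zx.
  by case/andP: h => /deg_gt0.
have [x0 _] := other (Ordinal (ltnW (ltnW n3))) (Ordinal (ltnW (ltnW n3))).
have S : \sum_y (2 - deg B y) = 2 by rewrite (forest_sum F).
have [u _ du] := forest_rep F x0.
have du1 : deg B u = 1 by apply/eqP; rewrite eqn_leq dpos andbT.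
have [v vu dv] : exists2 v, v != u & deg B v < 2.
  have [v /andP[]|h] := pickP [pred v | (v != u) && (deg B v < 2)]; first by exists v.
  move: S; rewrite (bigD1 u) //= big1 ?du1 // => y yu.
  by have /= := h y; rewrite yu /= ltnNge => /negbFE h2; apply/eqP; rewrite subn_eq0.
have dv1 : deg B v = 1 by apply/eqP; rewrite eqn_leq dpos andbT.
pose e := mkedge u v; have lt : e.1 < e.2 by apply: mkedge_lt; rewrite eq_sym.
have inc_e w : inc e w = (u == w) || (v == w) by rewrite /e inc_mkedge.
have eB : e \notin B.
  apply/negP => eB.
  have auv : adj B u v by rewrite /adj eq_sym vu.
  have [z zu zv] := other u v.
  have only x y w : deg B x = 1 -> adj B x y -> adj B x w -> w = y.
    move=> d1 ay aw; apply/eqP; apply: contraT => ne.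
    have : [set y; w] \subset nb B x by apply/subsetP => t /set2P[]->; rewrite inE.
    move/subset_leq_card/leq_trans/(_ (card_nb B x)).
    by rewrite cards2 d1 eq_sym ne.
  have : (u == z) || (v == z).
    have /connectP[p pp ->] := fo_conn F (forest_const F erefl u z).
    suff gen t : path (adj B) t p -> (u == t) || (v == t) -> (u == last t p) || (v == last t p).
      by apply: gen pp _; rewrite eqxx.
    elim: p t {pp} => //= w p IH t /andP[atw pw] ht; apply: IH pw _.
    case/orP: ht atw => /eqP <- h; first by rewrite (only _ _ _ du1 auv h) eqxx orbT.
    by rewrite adjC in auv; rewrite (only _ _ _ dv1 auv h) eqxx.
  by rewrite eq_sym (negbTE zu) eq_sym (negbTE zv).
have d2 w : deg (e |: B) w <= 2.
  rewrite deg_add // inc_e; case: (eqVneq u w) => [<-|_]; first by rewrite du1.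
  by case: (eqVneq v w) => [<-|_]; [rewrite dv1|apply: (fo_deg F)].
exists e; apply/and4P; split => //; first by apply/forallP.
apply/existsP => -[k /(forest1_cycle F d2) kn].
by have := ltn_ord k; rewrite kn ltnn.
Qed.

(** * Hamiltonian cycles and their interplay with forests *)

Lemma ordS_iter (i j : V) : exists k, j = iter k (@ordS n) i.
Proof.
exists (n - i + j); apply: val_inj.
have -> k (i0 : V) : val (iter k (@ordS n) i0) = (i0 + k) %% n.
  elim: k => [|k IH] /=; first by rewrite addn0 modn_small.
  by rewrite IH -addn1 modnDml addn1 addnS.
by rewrite addnA subnKC ?(ltnW (ltn_ord _)) // modnDl modn_small.
Qed.

Lemma mkedge_cycle_inj (f : 'I_n -> V) : 2 < n -> injective f ->
  injective (fun i => mkedge (f i) (f (ordS i))).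
Proof.
move=> n3 injf i j /mkedge_eq [[/injf //]|[/injf h1 /injf h2]].
by have := ordSS_neq j n3; rewrite -h1 h2 eqxx.
Qed.

Lemma hamP B : reflect (2 < n /\ exists f : {ffun V -> V},
   injective f /\ B = [set mkedge (f i) (f (ordS i)) | i : V]) (is_ham B).
Proof.
apply: (iffP andP) => [[n3 /existsP[f /andP[/injectiveP h1 /eqP h2]]]|[n3 [f [h1 h2]]]].
  by split=> //; exists f.
by split => //; apply/existsP; exists f; apply/andP; split; [apply/injectiveP|apply/eqP].
Qed.

Lemma ham_card B : is_ham B -> #|B| = n.
Proof.
case/hamP => n3 [f [injf ->]]; rewrite card_imset ?card_ord //.
exact: mkedge_cycle_inj.
Qed.

Lemma ham_ord B : is_ham B -> ordered B.
Proof.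
case/hamP => n3 [f [injf ->]] e /imsetP[i _ ->]; apply: mkedge_lt.
by rewrite (inj_eq injf) eq_sym ordS_neq // ltnW.
Qed.

Lemma cycle_ham B : 2 < n -> has_cycle_len B n -> #|B| = n -> is_ham B.
Proof.
move=> n3 /cycle_lenP[_ [f [injf cyc]]] cB; apply/hamP; split=> //; exists f; split => //.
apply/esym/eqP; rewrite eqEcard cB card_imset ?card_ord ?leqnn ?andbT; last exact: mkedge_cycle_inj.
by apply/subsetP => e /imsetP[i _ ->]; case/andP: (cyc i).
Qed.

Lemma forest1_ham B c e : 2 < n -> forest 1 B c -> admissible B e -> is_ham (e |: B).
Proof.
move=> n3 F adm; have /and4P[lt eB /forallP d2 _] := adm.
have [k hk _] := connect_cycle F lt eB (forest_const F erefl _ _).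
have kn := forest1_cycle F d2 hk; rewrite kn in hk; apply: cycle_ham => //.
by rewrite cardsU1 eB add1n -addn1 (forest_card F).
Qed.

(** The two cyclic neighbours give degree at least 2 everywhere, and the degree sum 2n leaves no
    room for more. *)
Lemma ham_deg H v : is_ham H -> deg H v = 2.
Proof.
move=> hH; have := sum_deg (ham_ord hH); rewrite (ham_card hH).
case/hamP: hH => n3 [f [injf eH]].
have d2 w : 2 <= deg H w.
  have [g fg gf] := injF_bij injf.
  apply: leq_trans (card_nb H w); rewrite -(gf w); set i := g w.
  have : [set f (ordS i); f (ord_pred i)] \subset nb H (f i).
    apply/subsetP => y /set2P[]->; rewrite inE /adj (inj_eq injf) ?[i == _]eq_sym.
      by rewrite ordS_neq ?(ltnW n3) // eH; apply/imsetP; exists i.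
    have -> /= : ord_pred i != i by rewrite -{2}(ord_predK i) eq_sym ordS_neq ?(ltnW n3).
    by rewrite mkedgeC eH; apply/imsetP; exists (ord_pred i); rewrite ?ord_predK.
  move/subset_leq_card; apply: leq_trans; rewrite cards2 (inj_eq injf).
  by rewrite -{1}(ord_predK i) ordSS_neq.
have : \sum_(w : V) 2 = n.*2 by rewrite sum_nat_const card_ord muln2.
move=> <- /eqP; rewrite eq_sym => /eqP S; apply/eqP; rewrite eqn_leq d2 andbT.
move: S; rewrite (bigD1 v) //= [RHS](bigD1 v) //=.
have : \sum_(i < n | i != v) 2 <= \sum_(i < n | i != v) deg H i by apply: leq_sum.
by move=> h1 h2; rewrite -(leq_add2r (\sum_(i | i != v) deg H i)) -h2 leq_add2l.
Qed.

(** Walking round H, each of the m classes must be left at some step, and steps that leave different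
    classes are different edges. *)
Lemma ham_crossing H m (c : V -> V) : is_ham H -> #|[set c x | x in [set: V]]| = m -> 1 < m ->
  m <= #|[set e in H | c e.1 != c e.2]|.
Proof.
case/hamP => n3 [f [injf ->]] cm m2.
pose X := [set i | c (f i) != c (f (ordS i))].
have : [set c x | x in [set: V]] \subset [set c (f i) | i in X].
  apply/subsetP => l /imsetP[x _ ->].
  have [g fg gf] := injF_bij injf.
  have [i /andP[i1 i2]|h] := pickP [pred i | (c (f i) == c x) && (i \in X)].
    by apply/imsetP; exists i; rewrite ?(eqP i1).
  have st j : c (f j) = c x -> c (f (ordS j)) = c x.
    move=> hj; have /= := h j; rewrite hj eqxx /= inE => /negbFE/eqP <-; exact: hj.
  have it k : c (f (iter k (@ordS n) (g x))) = c x.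
    by elim: k => [|k IH] /=; [rewrite gf|apply: st].
  have all1 y : c y = c x.
    rewrite -(gf y).
    by have [k ->] := ordS_iter (g x) (g y).
  move: m2; rewrite -cm; suff -> : [set c x | x in [set: V]] = [set c x] by rewrite cards1.
  by apply/setP => l'; rewrite inE; apply/imsetP/eqP => [[z _ ->]|->]; [|exists x].
move/subset_leq_card; rewrite cm => /leq_trans; apply.
apply: leq_trans (leq_imset_card _ _) _.
rewrite -(card_imset X (mkedge_cycle_inj n3 injf)); apply: subset_leq_card.
apply/subsetP => e /imsetP[i]; rewrite inE => hi ->; rewrite inE; apply/andP; split; first by apply/imsetP; exists i.
by rewrite /mkedge; case: ifP; rewrite // eq_sym.
Qed.

(** A crossing edge of H that is not admissible meets a vertex of degree 2 in [B]. As that vertex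
    has degree 2 in H too, it has as many H-edges outside [B] as [B]-edges outside H, so the blocked
    edges number at most the degree sum of [B :\: H]. *)
Lemma forest_ham_admissible H B m c : is_ham H -> forest m B c -> 1 < m ->
  m <= #|[set e in H | admissible B e]| + #|B :\: H|.*2.
Proof.
move=> hH F m2; apply: leq_trans (ham_crossing hH (fo_card F) m2) _.
pose X := [set e in H | c e.1 != c e.2].
have ncB e : e \in H -> c e.1 != c e.2 -> e \notin B.
  move=> eH; apply: contraNN => eB; apply/eqP/(fo_lab F).
  have lt := ham_ord hH eH; by rewrite /adj (mkedge_ord lt) eB -val_eqE neq_ltn lt.
pose Y := [set e in H :\: B | [exists v, inc e v && (deg B v == 2)]].
have : X \subset [set e in H | admissible B e] :|: Y.
  apply/subsetP => e; rewrite inE => /andP[eH nc].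
  rewrite in_setU; case: (boolP (e \in Y)) => eY; first by rewrite orbT.
  have eB := ncB e eH nc.
  rewrite orbF inE eH /=; apply: (cross_admissible F) => //; first exact: (ham_ord hH).
    rewrite ltn_neqAle (fo_deg F) andbT; apply: contraNN eY => h.
    by rewrite inE in_setD eB eH; apply/existsP; exists e.1; rewrite h /inc eqxx.
  rewrite ltn_neqAle (fo_deg F) andbT; apply: contraNN eY => h.
  by rewrite inE in_setD eB eH; apply/existsP; exists e.2; rewrite h /inc eqxx orbT.
move/subset_leq_card/leq_trans; apply.
apply: leq_trans (leq_card_setU _ _) _; rewrite leq_add2l.
have oBH : ordered (B :\: H) by move=> e; rewrite in_setD => /andP[_]; apply: (fo_ord F).
rewrite -(sum_deg oBH).
apply: (@leq_trans (\sum_(v | deg B v == 2) deg (H :\: B) v)).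
  under eq_bigr do rewrite degE.
  rewrite exchange_big -sum1_card /= big_mkcond [X in _ <= X]big_mkcond leq_sum // => e _.
  rewrite inE; case: (e \in _) => //=; case: ifP => // /existsP[v /andP[h1 h2]].
  by rewrite (bigD1 v) //= h1.
rewrite big_mkcond leq_sum // => v _; case: eqP => // d2.
have E A C : deg A v = deg (A :&: C) v + deg (A :\: C) v.
  by rewrite !degE (big_setID C).
have := E H B; have := E B H; rewrite (ham_deg v hH) d2 setIC; lia.
Qed.

(** The invariant of the generation, indexed by the number m of edges still to be added. The case m
    = 0 is separate because the last edge turns the path into a tour, which is no forest. *)
Definition gstate m B := if m is 0 then is_true (is_ham B) else exists c, forest m B c.

Lemma gstate_add m B e : 2 < n -> gstate m.+1 B -> admissible B e -> gstate m (e |: B).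
Proof.
move=> n3 [c F] adm; case: m F => [|m] F; first exact: forest1_ham F adm.
have /and4P[lt _ _ _] := adm; have [d1 d2] := admissible_deg adm.
by eexists; apply: (forest_add F) => //; apply: (admissible_cross F).
Qed.

Lemma gstate_card m B : gstate m B -> #|B| + m = n.
Proof. by case: m => [/ham_card ->|m [c /forest_card]]; rewrite ?addn0. Qed.

Lemma gstate_nham m B : gstate m.+1 B -> ~~ is_ham B.
Proof. by move/gstate_card => h; apply/negP => /ham_card hB; move: h; rewrite hB; lia. Qed.

Lemma gstate_admissible m B : 2 < n -> gstate m.+1 B -> exists e, admissible B e.
Proof.
move=> n3 [c F]; case: m F => [|m] F; first exact: forest1_admissible F.
have : 1 < #|[set c x | x in [set: V]]| by rewrite (fo_card F).
case/card_gt1P => _ [_ [/imsetP[x _ ->] /imsetP[y _ ->] nxy]].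
have [x' hx dx] := forest_rep F x; have [y' hy dy] := forest_rep F y.
have nc : c x' != c y' by rewrite hx hy.
have ne : x' != y' by apply: contraNneq nc => ->.
exists (mkedge x' y'); apply: (cross_admissible F); first exact: mkedge_lt.
- by rewrite /mkedge; case: ifP; rewrite // eq_sym.
- by rewrite /mkedge; case: ifP.
- by rewrite /mkedge; case: ifP.
Qed.

(** Both ends of an admissible edge have positive defect, and the total defect is [m.+1.*2]. *)
Lemma card_admissible m B : gstate m.+1 B -> #|[set e | admissible B e]| <= 4 * m.+1 ^ 2.
Proof.
move=> [c F]; pose S := [set v | deg B v < 2].
have hS : #|S| <= m.+1.*2.
  rewrite -(forest_sum F) -sum1_card big_mkcond leq_sum // => v _.
  by rewrite inE; case: ifP => // h; lia.
have : [set e | admissible B e] \subset setX S S.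
  apply/subsetP => e; rewrite !inE; move/(admissible_deg) => [-> ->] //.
move/subset_leq_card; rewrite cardsX => /leq_trans; apply.
by apply: leq_trans (leq_mul hS hS) _; rewrite -!mul2n mulnACA.
Qed.

(* Choose one vertex of degree < 2 in each component. *)
Lemma card_admissible_ge m B : 0 < m -> gstate m.+1 B ->
  m.+1 * m <= 2 * #|[set e | admissible B e]|.
Proof.
move=> m0 [c F]; pose L := [set c x | x in [set: V]].
have rep l : exists y, (l \in L) ==> (c y == l) && (deg B y < 2).
  case: (boolP (l \in L)) => [/imsetP[x _ ->]|_]; last by exists l.
  by have [y h1 h2] := forest_rep F x; exists y; rewrite h1 eqxx.
pose r l := xchoose (rep l).
have rP l : l \in L -> c (r l) = l /\ deg B (r l) < 2.
  by move=> hl; have /implyP/(_ hl)/andP[/eqP] := xchooseP (rep l).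
pose D := [set p : V * V | [&& p.1 \in L, p.2 \in L & p.1 != p.2]].
have cD : #|D| = m.+1 * m.
  have -> : D = setX L L :\: [set p | p.1 == p.2].
    by apply/setP => p; rewrite !inE; case: (p.1 \in L); case: (p.2 \in L); case: (p.1 == p.2).
  rewrite cardsD cardsX (_ : _ :&: _ = [set (l, l) | l in L]); last first.
    apply/setP => -[a b]; rewrite !inE /=.
    apply/idP/imsetP => [/andP[/andP[ha _] /eqP <-]|[l hl [-> ->]]]; first by exists a.
    by rewrite hl eqxx.
  rewrite card_imset; last by move=> a b [].
  by rewrite (fo_card F) mulnS addKn.
rewrite -cD; pose h (p : V * V) := mkedge (r p.1) (r p.2).
have hD p : p \in D -> admissible B (h p).
  rewrite inE => /and3P[h1 h2 h3]; have [c1 d1] := rP _ h1; have [c2 d2] := rP _ h2.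
  have nc : c (r p.1) != c (r p.2) by rewrite c1 c2.
  apply: (cross_admissible F).
  - by apply: mkedge_lt; apply: contraNneq nc => ->.
  - by rewrite /h /mkedge; case: ifP; rewrite // eq_sym.
  - by rewrite /h /mkedge; case: ifP.
  - by rewrite /h /mkedge; case: ifP.
rewrite -sum1_card (partition_big h (fun e => e \in [set e | admissible B e])) /=; last first.
  by move=> p /hD; rewrite inE.
rewrite mulnC -sum_nat_const; apply: leq_sum => e _.
rewrite sum1_card; have [p0 /andP[p0D /eqP p0e]|no] := pickP [pred p | (p \in D) && (h p == e)]; last first.
  rewrite (eq_card0 (A := _)) // => p; exact: no.
apply: (@leq_trans #|[set p0; (p0.2, p0.1)]|); last by rewrite cards2; case: (_ != _).
apply: subset_leq_card; apply/subsetP => p /andP[pD /eqP]; rewrite -p0e.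
move: pD p0D; rewrite !inE => /and3P[a1 a2 _] /and3P[b1 b2 _].
have [A1 _] := rP _ a1; have [A2 _] := rP _ a2; have [B1 _] := rP _ b1; have [B2 _] := rP _ b2.
move/mkedge_eq => [[E1 E2]|[E1 E2]]; rewrite -pair_eqE /pair_eq /=.
  by rewrite -A1 E1 B1 -A2 E2 B2 !eqxx.
by rewrite -A1 E1 B2 -A2 E2 B1 !eqxx orbT.
Qed.

Lemma gstate0 : 0 < n -> gstate n set0.
Proof.
move=> n0; have : forall m, m = n -> 0 < m -> gstate m set0; last exact.
by case=> // m e _; exists id; rewrite e; apply: forest0.
Qed.
End Graph.

Local Open Scope ring_scope.

(** * Edge-based generation *)

Section Generation.
Variables (R : realType) (n : nat).
Hypothesis n3 : (2 < n)%N.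
Local Notation V := 'I_n.
Local Notation edges := {set V * V}.
Implicit Types (pi : V -> V -> R) (B H A : edges) (e : V * V) (F : edges -> R).

(** The expectation of [F] at the tour into which the generation completes [B]. *)
Definition Egen pi k B F : R := \sum_H genP pi k B H * F H.

Definition positive_weights pi := forall e, (e.1 < e.2)%N -> 0 < ew pi e.

Definition weight pi B := \sum_(e | admissible B e) ew pi e.

Lemma Egen_ham pi k B F : is_ham B -> Egen pi k B F = F B.
Proof.
move=> hB; have E H : genP pi k B H = (B == H)%:R by case: k => [|k] /=; rewrite hB.
rewrite /Egen (bigD1 B) //= E eqxx mul1r big1 ?addr0 // => H nH.
by rewrite E eq_sym (negbTE nH) mul0r.
Qed.

Lemma EgenS pi k B F : ~~ is_ham B ->
  Egen pi k.+1 B F = \sum_(e | admissible B e) ew pi e / weight pi B * Egen pi k (e |: B) F.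
Proof.
move=> /negbTE hB; rewrite /Egen /= hB; under eq_bigr do rewrite mulr_suml.
rewrite exchange_big /=; apply: eq_bigr => e _; rewrite mulr_sumr.
by apply: eq_bigr => H _; rewrite mulrA.
Qed.

Lemma EgenD pi k B F F' : Egen pi k B (fun H => F H + F' H) = Egen pi k B F + Egen pi k B F'.
Proof. by rewrite -big_split; apply: eq_bigr => H _; rewrite mulrDr. Qed.

Lemma EgenZ pi k B F (a : R) : Egen pi k B (fun H => a * F H) = a * Egen pi k B F.
Proof. by rewrite mulr_sumr; apply: eq_bigr => H _; rewrite mulrCA. Qed.

Lemma Egen_sum pi k B (I : finType) (P : pred I) (F : I -> edges -> R) :
  Egen pi k B (fun H => \sum_(i | P i) F i H) = \sum_(i | P i) Egen pi k B (F i).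
Proof. by rewrite exchange_big; apply: eq_bigr => H _; rewrite mulr_sumr. Qed.

Lemma genP_nham pi k B H : ~~ is_ham H -> genP pi k B H = 0.
Proof.
move=> nH; elim: k B => [|k IH] B /=; case: ifP => // hB.
- by case: eqP => // E; rewrite -E hB in nH.
- by case: eqP => // E; rewrite -E hB in nH.
- by rewrite big1 // => e _; rewrite IH mulr0.
Qed.

Section Positive.
Variable pi : V -> V -> R.
Hypothesis pos : positive_weights pi.

Lemma ew_adm B e : admissible B e -> 0 < ew pi e.
Proof. by case/and4P => lt _ _ _; apply: pos. Qed.

Lemma weight_ge0 B : 0 <= weight pi B.
Proof. by apply: sumr_ge0 => e /ew_adm/ltW. Qed.

Lemma weight_gt0 m B : gstate m.+1 B -> 0 < weight pi B.
Proof.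
move/(gstate_admissible n3) => [e ae]; rewrite /weight (bigD1 e) //=.
by apply: ltr_pwDl; [exact: ew_adm ae|apply: sumr_ge0 => e' /andP[/ew_adm/ltW]].
Qed.

Lemma genP_ge0 k B H : 0 <= genP pi k B H.
Proof.
elim: k B => [|k IH] B /=; case: ifP => // _.
apply: sumr_ge0 => e ae; apply: mulr_ge0 => //.
by apply: mulr_ge0; [exact/ltW/(ew_adm ae)|rewrite invr_ge0 weight_ge0].
Qed.

Lemma Egen_mono k B F F' : (forall H, is_ham H -> F H <= F' H) -> Egen pi k B F <= Egen pi k B F'.
Proof.
move=> le; apply: ler_sum => H _; case: (boolP (is_ham H)) => hH.
  by apply: ler_wpM2l; [apply: genP_ge0|apply: le].
by rewrite genP_nham // !mul0r.
Qed.

(** Supermartingale principle: [f] dominates [F] at the end and does not grow on average in a step.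
    The step condition is multiplied by the total weight to avoid quotients. *)
Lemma Egen_le F (f : nat -> edges -> R) m B :
  (forall B, is_ham B -> F B <= f 0 B) ->
  (forall m B, gstate m.+1 B ->
    \sum_(e | admissible B e) ew pi e * f m (e |: B) <= weight pi B * f m.+1 B) ->
  gstate m B -> Egen pi m B F <= f m B.
Proof.
move=> f0 fS; elim: m B => [|m IH] B gB; first by rewrite Egen_ham //; apply: f0.
rewrite EgenS ?(gstate_nham gB) //.
have W0 := weight_gt0 gB; rewrite -(ler_pM2l W0) mulr_sumr; apply: le_trans (fS _ _ gB).
apply: ler_sum => e ae; rewrite mulrA mulrCA divff ?mulr1 ?gt_eqF //.
by apply: ler_wpM2l; [exact/ltW/(ew_adm ae)|apply: IH; apply: gstate_add gB ae].
Qed.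

Lemma Egen1 m B : gstate m B -> Egen pi m B (fun=> 1) = 1.
Proof.
elim: m B => [|m IH] B gB; first by rewrite Egen_ham.
rewrite EgenS ?(gstate_nham gB) // (eq_bigr (fun e => ew pi e / weight pi B)).
  by rewrite -mulr_suml divff // gt_eqF // (weight_gt0 gB).
by move=> e ae; rewrite IH ?mulr1 //; apply: gstate_add gB ae.
Qed.

Lemma cardsIU1 B A e : e \notin B -> #|(e |: B) :&: A| = ((e \in A) + #|B :&: A|)%N.
Proof.
move=> eB; rewrite setIUl cardsU.
have -> : [set e] :&: A :&: (B :&: A) = set0.
  apply/setP => x; rewrite !inE; case: eqP => //= ->; by rewrite (negbTE eB) andbF.
rewrite cards0 subn0; congr addn; case: (boolP (e \in A)) => eA.
  by have /setIidPl -> : [set e] \subset A; rewrite ?sub1set ?cards1.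
by have /eqP -> : [set e] :&: A == set0; rewrite ?setI_eq0 ?disjoints1 ?cards0.
Qed.

(** Until only [m0] edges remain, each pick lies in [A] with conditional probability at least [q],
    which multiplies the expectation by at most 1 - (1 - x)q; later picks contribute at most 1, as
    the truncated [m - m0] records. At [x = 0] the left side is the probability of avoiding [A]. *)
Lemma Egen_power_le A (x q : R) m0 m B : 0 <= x <= 1 -> 0 <= q <= 1 ->
  (forall m B, (m0 <= m)%N -> gstate m.+1 B ->
     q * weight pi B <= \sum_(e | admissible B e && (e \in A)) ew pi e) ->
  gstate m B ->
  Egen pi m B (fun H => x ^+ #|H :&: A|) <= x ^+ #|B :&: A| * (1 - (1 - x) * q) ^+ (m - m0).
Proof.
move=> /andP[x0 x1] /andP[q0 q1] hq.
apply: (Egen_le (f := fun m B => x ^+ #|B :&: A| * (1 - (1 - x) * q) ^+ (m - m0))).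
  by move=> B' _; rewrite sub0n expr0 mulr1.
move=> {B} m' B gB; set rho := 1 - _.
have rho0 : 0 <= rho by rewrite /rho; nra.
have E e : admissible B e -> ew pi e * (x ^+ #|(e |: B) :&: A| * rho ^+ (m' - m0)) =
   x ^+ #|B :&: A| * rho ^+ (m' - m0) * (ew pi e * x ^+ (e \in A)).
  by case/and4P => _ eB _ _; rewrite cardsIU1 // exprD; ring.
rewrite (eq_bigr _ E) -mulr_sumr.
have S : \sum_(e | admissible B e) ew pi e * x ^+ (e \in A) =
    weight pi B - (1 - x) * \sum_(e | admissible B e && (e \in A)) ew pi e.
  rewrite /weight mulr_sumr [X in _ = _ - X]big_mkcondr /= -sumrB; apply: eq_bigr => e _.
  by case: (e \in A); rewrite ?expr1 ?expr0 ?subr0; ring.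
rewrite S [weight pi B * _]mulrCA -!mulrA; apply: ler_wpM2l; first exact: exprn_ge0.
have [le|gt] := leqP m0 m'.
  have -> : weight pi B * rho ^+ (m'.+1 - m0) = rho ^+ (m' - m0) * (rho * weight pi B).
    by rewrite subSn // exprS; ring.
  apply: ler_wpM2l; first exact: exprn_ge0.
  by have := hq _ _ le gB; rewrite /rho; nra.
have -> : (m' - m0 = 0)%N by lia.
have -> : (m'.+1 - m0 = 0)%N by lia.
rewrite expr0 mul1r mulr1 lerBlDr lerDl; apply: mulr_ge0; first lra.
by apply: sumr_ge0 => e /andP[/ew_adm/ltW].
Qed.
End Positive.

Lemma ew_Pi0 e : (e.1 < e.2)%N -> ew (Pi0 R n) e = 2 / (n%:R - 1).
Proof.
move=> lt; have n12 : (e.1 == e.2) = false by rewrite -val_eqE ltn_eqF.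
by rewrite /ew /Pi0 [e.2 == _]eq_sym n12; lra.
Qed.

Lemma natr_ge3 : 3 <= n%:R :> R. Proof. by rewrite ler_nat. Qed.

Lemma pos_Pi0 : positive_weights (Pi0 R n).
Proof. by move=> e lt; rewrite ew_Pi0 // divr_gt0 //; have := natr_ge3; lra. Qed.

Lemma ew_PiH H e : (e.1 < e.2)%N ->
  ew (PiH R H) e = if e \in H then 2 * (1 - 1 / n%:R) else 2 / (n%:R * (n%:R - 2)).
Proof.
move=> lt; have n12 : (e.1 == e.2) = false by rewrite -val_eqE ltn_eqF.
rewrite /ew /PiH [e.2 == _]eq_sym n12.
by rewrite [mkedge e.2 _]mkedgeC mkedge_ord //; case: ifP => _; lra.
Qed.

Lemma invn_le : n%:R^-1 <= 3^-1 :> R.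
Proof. by rewrite lef_pV2 ?posrE ?ltr0n ?(ltn_trans _ n3) // natr_ge3. Qed.

Lemma pos_PiH H : positive_weights (PiH R H).
Proof.
move=> e lt; rewrite ew_PiH //; case: ifP => _; first by have := invn_le; lra.
by rewrite divr_gt0 // mulr_gt0 //; have := natr_ge3; lra.
Qed.

(** * Exponential moment of the number of new edges *)

Section PowerMoment.
Variables (H : edges) (hH : is_ham H) (n27 : (27 <= n)%N).
Let pi := PiH R H.

(** Write M = m + 1. More than M/2 edges of H are still admissible, each of weight nearly 2, against
    at most 4M^2 other edges of weight 2/(n(n-2)). The ratio is about 8M/n^2, and M <= n. *)
Lemma nonham_weight m B : (1 < m.+1)%N -> (4 * #|B :\: H| < m.+1)%N -> gstate m.+1 B ->
  \sum_(e | admissible B e && (e \notin H)) ew pi e <= 9 / n%:R * weight pi B.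
Proof.
move=> m2 rm gB; have Mn : (m.+1 <= n)%N by rewrite -(gstate_card gB) leq_addl.
have c1 := card_admissible gB; case: (gB) => c F.
have c2 := forest_ham_admissible hH F m2.
set N := (n%:R : R); set M := (m.+1%:R : R).
have hN : 27 <= N by rewrite ler_nat.
have hM : M <= N by rewrite ler_nat.
have M0 : 0 < M by rewrite ltr0n.
set h := #|[set e in H | admissible B e]| in c2.
have hh : M <= 2 * h%:R.
  rewrite -(natrM _ 2) ler_nat; lia.
have Wge : h%:R * (2 * (1 - 1 / N)) <= weight pi B.
  rewrite /weight (bigID (mem H)) /= -[X in X <= _]addr0; apply: lerD; last first.
    by apply: sumr_ge0 => e /andP[/(ew_adm (@pos_PiH H))/ltW].
  rewrite /h -sum1_card natr_sum mulr_suml.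
  rewrite [X in X <= _](eq_bigl (fun e => admissible B e && (e \in H))); last first.
    by move=> e; rewrite inE andbC.
  by apply: ler_sum => e /andP[/and4P[lt _ _ _] eH]; rewrite ew_PiH // eH [leLHS]mul1r.
have Wle : \sum_(e | admissible B e && (e \notin H)) ew pi e <= 4 * M ^+ 2 * (2 / (N * (N - 2))).
  apply: (@le_trans _ _ (\sum_(e | admissible B e) (2 / (N * (N - 2))))).
    rewrite [X in _ <= X](bigID (mem H)) /= -[X in X <= _]add0r; apply: lerD.
      by apply: sumr_ge0 => e _; rewrite divr_ge0 // mulr_ge0; lra.
    by apply: ler_sum => e /andP[/and4P[lt _ _ _] /negbTE eH]; rewrite ew_PiH // eH.
  rewrite sumr_const -[X in X <= _]mulr_natl; apply: ler_wpM2r.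
    by rewrite divr_ge0 // mulr_ge0; lra.
  by rewrite -natrX -(natrM _ 4) ler_nat; apply: leq_trans c1; rewrite cardsE.
apply: (le_trans Wle); apply: (@le_trans _ _ (9 / N * (M / 2 * (2 * (1 - 1 / N))))); last first.
  apply: ler_wpM2l; first by rewrite divr_ge0; lra.
  apply: le_trans Wge; apply: ler_wpM2r; last by lra.
  have : 1 / N <= 1 by rewrite ler_pdivrMr; lra.
  lra.
have -> : 4 * M ^+ 2 * (2 / (N * (N - 2))) = (8 * M ^+ 2 * N) / (N ^+ 2 * (N - 2)).
  by field; apply/andP; split; apply/eqP; lra.
have -> : 9 / N * (M / 2 * (2 * (1 - 1 / N))) = (9 * M * (N - 1) * (N - 2)) / (N ^+ 2 * (N - 2)).
  by field; apply/andP; split; apply/eqP; lra.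
apply: ler_wpM2r; first by rewrite invr_ge0 mulr_ge0 ?exprn_ge0; lra.
have -> : 8 * M ^+ 2 * N = M * (8 * (M * N)) by ring.
have -> : 9 * M * (N - 1) * (N - 2) = M * (9 * ((N - 1) * (N - 2))) by ring.
apply: ler_wpM2l; first exact: ltW.
(* Here [27 <= n] enters: it gives 8N^2 <= 9(N - 1)(N - 2). *)
have : M * N <= N * N by apply: ler_wpM2r => //; lra.
nra.
Qed.

(* Once the forest has few components compared with the number r of non-H edges, or only
   one, all remaining choices are counted as non-H; before that, a non-H edge has
   conditional probability at most 9/n. *)
Let potential (g : R) m B :=
  if (1 < m)%N && (4 * #|B :\: H| < m)%N then g * (1 + 9 / n%:R) ^+ m * g ^+ (5 * #|B :\: H|)
  else g ^+ (#|B :\: H| + m).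

Lemma cardsDU1 B e : e \notin B -> #|(e |: B) :\: H| = ((e \notin H) + #|B :\: H|)%N.
Proof. by move=> eB; rewrite !setDE cardsIU1 // in_setC. Qed.

(** The exponent 5 pays once for a non-H edge and four times for the late phase, which has at most
    four edges per non-H edge; the leading [g] covers a last single edge. As [g ^+ 5 <= 2], an early
    pick multiplies the expectation by at most 1 + 9/n, and n picks give e^9. *)
Lemma power_moment (g : R) : 1 <= g -> g ^+ 5 <= 2 ->
  Egen pi n set0 (fun H' => g ^+ #|H' :\: H|) <= g * expR 9.
Proof.
move=> g1 g5; have g0 : 0 <= g by lra.
have nN : 27 <= n%:R :> R by rewrite ler_nat.
have b1 : 1 <= 1 + 9 / n%:R :> R by rewrite lerDl divr_ge0; lra.
apply: (@le_trans _ _ (potential g n set0)); last first.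
  rewrite /potential set0D cards0 muln0 expr0 mulr1 !(ltn_trans _ n3) //=.
  apply: ler_wpM2l => //; apply: (@le_trans _ _ (expR (9 / n%:R) ^+ n)).
    by apply: lerXn2r; rewrite ?nnegrE ?expR_ge0 ?expR_ge1Dx //; lra.
  by rewrite -expRM_natl mulrC divfK // gt_eqF //; lra.
apply: (Egen_le (@pos_PiH H) (f := potential g)); last by apply: gstate0; apply: ltn_trans n3.
  by move=> B _; rewrite /potential /= addn0.
move=> m B gB; rewrite {2}/potential; case: ifP => hm.
  case/andP: hm => m2 rm.
  apply: (@le_trans _ _ (\sum_(e | admissible B e)
      g * (1 + 9 / n%:R) ^+ m * g ^+ (5 * #|B :\: H|) * (ew pi e * (g ^+ 5) ^+ (e \notin H)))).
    apply: ler_sum => e ae; have /and4P[_ eB _ _] := ae.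
    rewrite mulrCA; apply: ler_wpM2l; first exact/ltW/(ew_adm (@pos_PiH H) ae).
    have -> : g * (1 + 9 / n%:R) ^+ m * g ^+ (5 * #|B :\: H|) * g ^+ 5 ^+ (e \notin H) =
        g * (1 + 9 / n%:R) ^+ m * g ^+ (5 * #|(e |: B) :\: H|).
      by rewrite -[g ^+ 5 ^+ _]exprM cardsDU1 // mulnDr exprD; ring.
    (* At the switch to the late phase m <= 4r or m <= 1, with r the new count, so the early
       exponent 1 + 5r dominates r + m. *)
    rewrite /potential; case: ifP => // hm.
    apply: (@le_trans _ _ (g * 1 * g ^+ (5 * #|(e |: B) :\: H|))).
      by rewrite mulr1 -exprS; apply: ler_weXn2l => //; move: hm m2 rm; rewrite cardsDU1 //; case: (e \notin H); lia.
    by apply: ler_wpM2r; [exact: exprn_ge0|apply: ler_wpM2l => //; apply: exprn_ege1].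
  rewrite -mulr_sumr.
  have -> : \sum_(e | admissible B e) ew pi e * (g ^+ 5) ^+ (e \notin H) =
     weight pi B + (g ^+ 5 - 1) * \sum_(e | admissible B e && (e \notin H)) ew pi e.
    rewrite /weight mulr_sumr [X in _ = _ + X]big_mkcondr /= -big_split; apply: eq_bigr => e _ /=.
    by case: (e \in H); rewrite ?expr1 ?expr0 /=; ring.
  set S := (X in (g ^+ 5 - 1) * X); set W := weight pi B; set c := g * _ * _.
  have -> : W * (g * (1 + 9 / n%:R) ^+ m.+1 * g ^+ (5 * #|B :\: H|)) =
    c * (W + 9 / n%:R * W) by rewrite /c [_ ^+ m.+1]exprS; ring.
  apply: ler_wpM2l; first by rewrite /c !mulr_ge0 ?exprn_ge0 //; lra.
  rewrite lerD2l; apply: le_trans (nonham_weight m2 rm gB).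
  rewrite -/S ler_piMl ?lerBlDr //; apply: sumr_ge0 => e /andP[ae _].
  exact/ltW/(ew_adm (@pos_PiH H) ae).
rewrite /weight mulr_suml; apply: ler_sum => e ae; have /and4P[_ eB _ _] := ae.
apply: ler_wpM2l; first exact/ltW/(ew_adm (@pos_PiH H) ae).
rewrite /potential cardsDU1 //; case: ifP => hm'.
  by move: hm hm'; case: (e \notin H); lia.
by apply: ler_weXn2l => //; case: (e \notin H); lia.
Qed.
End PowerMoment.
End Generation.

(** * Relabelling symmetry *)

Section Symmetry.
Variables (n : nat).
Local Notation V := 'I_n.
Local Notation edges := {set V * V}.
Implicit Types (B H : edges) (e : V * V) (s : {perm V}).

(* The action on the pairs that do not encode an edge only serves to make eact bijective. *)
Definition eact s e : V * V :=
  let p := mkedge (s e.1) (s e.2) in if (e.2 < e.1)%N then (p.2, p.1) else p.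

Lemma eactK s : cancel (eact s) (eact s^-1%g).
Proof.
move=> [a b]; rewrite /eact /mkedge /=.
case: (ltngtP b a) => [h|h|/val_inj ->] /=; last by rewrite ltnn /= ltnn !permK ltnn.
  case: (ltngtP (s a) (s b)) => [h2|h2|/val_inj/perm_inj e] /=.
  - by rewrite h2 !permK h.
  - by rewrite h2 !permK [(a < b)%N]ltnNge ltnW.
  - by move: h; rewrite e ltnn.
case: (ltngtP (s a) (s b)) => [h2|h2|/val_inj/perm_inj e] /=.
- by rewrite [(s b < s a)%N]ltnNge ltnW //= !permK h.
- by rewrite [(s a < s b)%N]ltnNge ltnW //= !permK [(b < a)%N]ltnNge ltnW.
- by move: h; rewrite e ltnn.
Qed.

Lemma eact_inj s : injective (eact s).
Proof. exact: can_inj (eactK s). Qed.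

Lemma eactKV s : cancel (eact s^-1%g) (eact s).
Proof. by rewrite -{2}[s]invgK; apply: eactK. Qed.

Lemma eact_imK s B : [set eact s^-1%g e | e in [set eact s e | e in B]] = B.
Proof.
rewrite -imset_comp (eq_imset (g := id)) ?imset_id // => e /=; exact: eactK.
Qed.

Lemma eact_ordered s e : (e.1 < e.2)%N -> eact s e = mkedge (s e.1) (s e.2).
Proof. by move=> lt; rewrite /eact [(e.2 < e.1)%N]ltnNge ltnW. Qed.

Lemma eact_mkedge s x y : x != y -> eact s (mkedge x y) = mkedge (s x) (s y).
Proof.
move=> ne; rewrite (eact_ordered s (mkedge_lt ne)).
by have [->|->] : mkedge x y = (x, y) \/ mkedge x y = (y, x);
  [rewrite /mkedge; case: ifP; auto| |rewrite mkedgeC].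
Qed.

Lemma eact_lt s e : (e.1 < e.2)%N -> ((eact s e).1 < (eact s e).2)%N.
Proof.
move=> lt; rewrite eact_ordered //; apply: mkedge_lt.
by rewrite (inj_eq perm_inj) -val_eqE neq_ltn lt.
Qed.

Lemma adj_eact s B x y : adj [set eact s e | e in B] (s x) (s y) = adj B x y.
Proof.
rewrite /adj (inj_eq perm_inj); case: eqVneq => //= ne.
by rewrite -eact_mkedge // mem_imset //; exact: eact_inj.
Qed.

Lemma inc_eact s e v : inc (eact s e) (s v) = inc e v.
Proof.
have -> : inc (eact s e) (s v) = inc (mkedge (s e.1) (s e.2)) (s v).
  by rewrite /eact; case: ifP => //=; rewrite /inc /= orbC.
by rewrite inc_mkedge !(inj_eq perm_inj).
Qed.

Lemma deg_eact s B v : deg [set eact s e | e in B] (s v) = deg B v.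
Proof.
rewrite !degE big_imset /=; last by move=> e e' _ _; exact: eact_inj.
by apply: eq_bigr => e _; rewrite inc_eact.
Qed.

Lemma cycle_eact s B k : has_cycle_len [set eact s e | e in B] k = has_cycle_len B k.
Proof.
have imp s' B' : has_cycle_len B' k -> has_cycle_len [set eact s' e | e in B'] k.
  case/cycle_lenP => k3 [f [injf cyc]]; apply/cycle_lenP; split => //.
  exists [ffun i => s' (f i)]; split=> [i j|i]; rewrite !ffunE; last by rewrite adj_eact.
  by move/perm_inj/injf.
by apply/idP/idP => [/(imp s^-1%g)|]; [rewrite eact_imK|apply: imp].
Qed.

Lemma ham_eact s B : is_ham [set eact s e | e in B] = is_ham B.
Proof.
have imp s' B' : is_ham B' -> is_ham [set eact s' e | e in B'].
  case/hamP => n3 [f [injf ->]]; apply/hamP; split => //.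
  exists [ffun i => s' (f i)]; split=> [i j|]; first by rewrite !ffunE => /perm_inj/injf.
  rewrite -imset_comp; apply: eq_imset => i /=; rewrite !ffunE eact_mkedge //.
  by rewrite (inj_eq injf) eq_sym ordS_neq // ltnW.
by apply/idP/idP => [/(imp s^-1%g)|]; [rewrite eact_imK|apply: imp].
Qed.

Lemma admissible_eact s B e : admissible [set eact s e | e in B] (eact s e) = admissible B e.
Proof.
have imp s' B' e' : admissible B' e' -> admissible [set eact s' e | e in B'] (eact s' e').
  case/and4P => lt eB /forallP d2 sc; apply/and4P; split.
  - exact: eact_lt.
  - by rewrite mem_imset //; exact: eact_inj.
  - apply/forallP => v; rewrite -imsetU1 -(permKV s' v) deg_eact; exact: d2.
  - rewrite -imsetU1; apply: contra sc => /existsP[k]; rewrite cycle_eact => h.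
    by apply/existsP; exists k.
by apply/idP/idP => [/(imp s^-1%g)|]; [rewrite eact_imK eactK|apply: imp].
Qed.

(** Admissibility depends only on the graph up to isomorphism, so the generation commutes with every
    relabelling that preserves the weights. *)
Lemma Egen_eact (R : realType) (pi : V -> V -> R) s :
  (forall e, (e.1 < e.2)%N -> ew pi (eact s e) = ew pi e) ->
  forall k B F, Egen pi k [set eact s e | e in B] F =
                Egen pi k B (fun H => F [set eact s e | e in H]).
Proof.
move=> inv; have bij : bijective (eact s) by exists (eact s^-1%g); [exact: eactK|exact: eactKV].
have W B : weight pi [set eact s e | e in B] = weight pi B.
  rewrite /weight (reindex (eact s)) /=; last exact: onW_bij.
  rewrite (eq_bigl _ _ (admissible_eact s B)); apply: eq_bigr => e /and4P[lt _ _ _]; exact: inv.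
elim=> [|k IH] B F; case: (boolP (is_ham B)) => hB; try by rewrite !Egen_ham ?ham_eact.
  rewrite /Egen !big1 // => H _ /=; first by rewrite (negbTE hB) mul0r.
  by rewrite ham_eact (negbTE hB) mul0r.
rewrite !EgenS ?ham_eact // W (reindex (eact s)) /=; last exact: onW_bij.
rewrite (eq_bigl _ _ (admissible_eact s B)); apply: eq_bigr => e /and4P[lt _ _ _].
by rewrite inv // -imsetU1 IH.
Qed.
End Symmetry.

(** * Gains and losses of one sample *)

Lemma bernoulli_ge (R : realType) (g : R) k : 1 <= g -> 1 + k%:R * (g - 1) <= g ^+ k.
Proof.
move=> g1; elim: k => [|k IH]; first by rewrite mul0r addr0 expr0.
rewrite exprS -natr1; have : g * (1 + k%:R * (g - 1)) <= g * g ^+ k by apply: ler_wpM2l => //; lra.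
have : 0 <= k%:R * (g - 1) by apply: mulr_ge0 => //; lra.
nra.
Qed.

(** A division-free form of (1 - q)^k <= 1/(1 + kq), which is bounded away from 1 as soon as kq is
    bounded away from 0. *)
Lemma bernoulli_le (R : realType) (q : R) k : 0 <= q <= 1 -> (1 - q) ^+ k * (1 + k%:R * q) <= 1.
Proof.
move=> /andP[q0 q1]; elim: k => [|k IH]; first by rewrite mul0r addr0 expr0 mulr1.
apply: le_trans IH; rewrite exprS mulrAC [leLHS]mulrC; apply: ler_wpM2l.
  by apply: exprn_ge0; lra.
have : 0 <= k%:R * q by apply: mulr_ge0.
by rewrite -natr1; nra.
Qed.

Section OneSample.
Variables (R : realType) (n : nat).
Hypothesis n3 : (2 < n)%N.
Local Notation V := 'I_n.
Local Notation edges := {set V * V}.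
Implicit Types (H S : edges).

Lemma ham_diff_card H S : is_ham H -> is_ham S -> #|H :\: S| = #|S :\: H|.
Proof. by move=> hH hS; rewrite !cardsD (ham_card hH) (ham_card hS) setIC. Qed.

(** In the first half of the picks there are at least m(m+1)/2 admissible edges of equal weight, of
    which at most n lie in [S]. So each pick avoids [S] with probability at least 1/2. *)
Lemma first_sample S (x : R) : is_ham S -> (48 <= n)%N -> 0 <= x <= 1 ->
  Egen (Pi0 R n) n set0 (fun H' => x ^+ #|H' :\: S|) <= (1 - (1 - x) / 2) ^+ (n - (n.+1)./2).
Proof.
move=> hS n48 x01; have pos := @pos_Pi0 R n n3.
have g0 : gstate n (set0 : edges) by apply: gstate0; lia.
have hN : 48 <= n%:R :> R by rewrite ler_nat.
have := Egen_power_le n3 pos (A := ~: S) (q := 2^-1) (m0 := (n.+1)./2) x01 _ _ g0.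
rewrite set0I cards0 expr0 mul1r.
have -> : Egen (Pi0 R n) n set0 (fun H' => x ^+ #|H' :\: S|) =
  Egen (Pi0 R n) n set0 (fun H' => x ^+ #|H' :&: ~: S|).
  by apply: eq_bigr => H' _; rewrite setDE.
apply; first by lra.
move=> m B hm gB.
have /card_admissible_ge/(_ gB) c2 : (0 < m)%N by lia.
have cA : (#|[set e | admissible B e]| <= 2 * #|[set e | admissible B e && (e \in ~: S)]|)%N.
  have : [set e | admissible B e] \subset [set e | admissible B e && (e \in ~: S)] :|: S.
    by apply/subsetP => e; rewrite !inE => ->; case: (e \in S).
  move/subset_leq_card; have := (leq_card_setU [set e | admissible B e && (e \in ~: S)] S).1.
  rewrite (ham_card hS); have nm : (n <= 2 * m)%N by lia.
  have : (n ^ 2 <= 4 * (m.+1 * m))%N by nia.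
  have : (28 * n <= n ^ 2)%N by nia.
  lia.
have sumE P : \sum_(e | admissible B e && P e) ew (Pi0 R n) e =
   #|[set e | admissible B e && P e]|%:R * (2 / (n%:R - 1)).
  rewrite -sum1_card natr_sum mulr_suml [RHS](eq_bigl (fun e => admissible B e && P e)); last first.
    by move=> e; rewrite inE.
  by apply: eq_bigr => e /andP[/and4P[lt _ _ _] _]; rewrite ew_Pi0 // mul1r.
have -> : weight (Pi0 R n) B = #|[set e | admissible B e]|%:R * (2 / (n%:R - 1)).
  rewrite /weight (eq_bigl (fun e => admissible B e && xpredT e)); last by move=> e; rewrite andbT.
  rewrite sumE; congr (_%:R * _); congr #|pred_of_set _|; by apply/setP => e; rewrite !inE andbT.
rewrite (sumE (fun e => e \in ~: S)); set d := 2 / _.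
rewrite [leLHS]mulrA; apply: ler_wpM2r; first by rewrite divr_ge0 //; lra.
by rewrite mulrC ler_pdivrMr // mulrC -(natrM _ 2) ler_nat.
Qed.

(* Rotating H shows that all its edges are equally likely to be lost. *)
Lemma lost_edge H f : is_ham H -> f \in H ->
  n%:R * Egen (PiH R H) n set0 (fun H' => (f \notin H')%:R) =
  Egen (PiH R H) n set0 (fun H' => #|H' :\: H|%:R).
Proof.
move=> hH; have [_ [phi [inj eH]]] := hamP _ hH.
have [psi phiK psiK] := injF_bij inj.
pose h i := mkedge (phi i) (phi (ordS i)).
have hinj : injective h by apply: mkedge_cycle_inj.
have inj_rot : injective (fun x => phi (ordS (psi x))).
  by apply: inj_comp inj _; apply: inj_comp (bij_inj (@ordS_bij n)) (can_inj psiK).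
pose s := perm inj_rot.
have sphi i : s (phi i) = phi (ordS i) by rewrite permE phiK.
have neq i : phi i != phi (ordS i) by rewrite (inj_eq inj) eq_sym ordS_neq // ltnW.
have sh i : eact s (h i) = h (ordS i) by rewrite /h eact_mkedge ?sphi.
have sH : [set eact s e | e in H] = H.
  apply/eqP; rewrite eqEcard card_imset ?leqnn ?andbT; last exact: eact_inj.
  apply/subsetP => e /imsetP[e']; rewrite eH => /imsetP[i _ ->] ->; rewrite -/(h i) sh.
  by apply/imsetP; exists (ordS i).
have inv (e : V * V) : (e.1 < e.2)%N -> ew (PiH R H) (eact s e) = ew (PiH R H) e.
  move=> lt; rewrite !ew_PiH ?eact_lt //.
  by rewrite -[in LHS]sH mem_imset //; exact: eact_inj.
pose P i := Egen (PiH R H) n set0 (fun H' => (h i \notin H')%:R).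
have PS i : P (ordS i) = P i.
  rewrite /P -(imset0 (eact s)) (Egen_eact inv) imset0; apply: eq_bigr => H' _.
  by rewrite -sh mem_imset //; exact: eact_inj.
have Pc i j : P j = P i.
  by have [k ->] := ordS_iter i j; elim: k => //= k IH; rewrite PS.
rewrite [in f \in H]eH => /imsetP[i _ ->]; rewrite -/(h i) -/(P i).
have -> : n%:R * P i = \sum_j P j.
  by rewrite (eq_bigr (fun=> P i)) // sumr_const card_ord mulr_natl.
rewrite /P -Egen_sum; apply: eq_bigr => H' _.
case: (boolP (is_ham H')) => hH'; last by rewrite genP_nham // !mul0r.
congr (_ * _); rewrite ham_diff_card // -natr_sum; congr _%:R.
have -> : H :\: H' = [set h i | i in [set i | h i \notin H']].
  apply/setP => e; rewrite in_setD; apply/andP/imsetP => [[e1]|[j]].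
    by rewrite eH => /imsetP[j _ E]; exists j => //; rewrite inE /h -E.
  by rewrite inE => hj ->; split => //; rewrite eH; apply/imsetP; exists j.
by apply/esym; rewrite card_imset // -sum1_card big_mkcond; apply: eq_bigr => j _; rewrite inE; case: (h j \in H').
Qed.

Variables (H S : edges).
Hypotheses (hH : is_ham H) (hS : is_ham S).
Let E := Egen (PiH R H) n set0.
Let k := #|S :\: H|.

Definition moment_bound (g : R) := g * expR 9.

(** Bernoulli's inequality turns the exponential moment into a bound on the mean number of lost
    edges, which rotation spreads evenly over H. *)
Lemma lost_edge_le (g : R) f : (27 <= n)%N -> 1 < g -> g ^+ 5 <= 2 -> f \in H ->
  n%:R * E (fun H' => (f \notin H')%:R) <= moment_bound g / (g - 1).
Proof.
move=> n27 g1 g5 fH; rewrite /E lost_edge //.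
have g10 : 0 < g - 1 by lra.
rewrite ler_pdivlMr // mulrC -EgenZ; apply: le_trans (power_moment n3 hH n27 (ltW g1) g5).
apply: Egen_mono => [|H' _]; first exact: pos_PiH.
by have := bernoulli_ge #|H' :\: H| (ltW g1); lra.
Qed.

(** Both tours have degree 2 at [u], so a new edge there displaces an old one. *)
Lemma ham_lost_edge H' e u : is_ham H' -> e \in H' -> e \notin H -> inc e u ->
  exists f, [/\ f \in H, inc f u & f \notin H'].
Proof.
move=> hH' eH' eH eu.
case: (pickP [pred f | [&& f \in H, inc f u & f \notin H']]) => [f /and3P[]|no]; first by exists f.
have := ham_deg u hH'; rewrite degE (bigD1 e) //= eu -(ham_deg u hH) degE.
have : (\sum_(f in H) inc f u <= \sum_(i in H' | i != e) inc i u)%N.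
  rewrite big_mkcond [X in (_ <= X)%N]big_mkcond leq_sum // => f _.
  case: ifP => // fH; have := no f; rewrite /= fH /=; case: (inc f u) => //= /negbFE ->.
  by rewrite /= (memPn eH _ fH).
by move=> h1 h2; move: h1; rewrite -h2 add1n ltnn.
Qed.

(** Union bound: gaining one of the k missing edges displaces one of the two H-edges at its first
    end, hence 2k events. *)
Lemma gain_prob (g : R) : (27 <= n)%N -> 1 < g -> g ^+ 5 <= 2 ->
  n%:R * E (fun H' => (H' :&: (S :\: H) != set0)%:R) <= 2 * k%:R * (moment_bound g / (g - 1)).
Proof.
move=> n27 g1 g5.
have C0 : 0 <= moment_bound g / (g - 1).
  by rewrite divr_ge0 ?mulr_ge0 ?expR_ge0 //; lra.
apply: (@le_trans _ _ (n%:R * E (fun H' =>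
    \sum_(e in S :\: H) \sum_(f in [set f in H | inc f e.1]) (f \notin H')%:R))).
  apply: ler_wpM2l; first exact: ler0n.
  apply: Egen_mono => [|H' hH']; first exact: pos_PiH.
  have [_|/set0Pn[e]] := eqVneq (H' :&: (S :\: H)) set0.
    by apply: sumr_ge0 => e _; apply: sumr_ge0.
  rewrite in_setI => /andP[eH' eSH]; have := eSH; rewrite in_setD => /andP[eH _].
  have [|f [fH fe fH']] := ham_lost_edge (u := e.1) hH' eH' eH; first by rewrite /inc eqxx.
  rewrite (bigD1 e) //= (bigD1 f) /= ?inE ?fH // fH' -addrA lerDl addr_ge0 //.
    exact: sumr_ge0.
  by apply: sumr_ge0 => e' _; apply: sumr_ge0.
rewrite /E Egen_sum mulr_sumr.
have -> : 2 * k%:R * (moment_bound g / (g - 1)) =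
    \sum_(e in S :\: H) 2 * (moment_bound g / (g - 1)).
  by rewrite sumr_const -[RHS]mulr_natl -/k; ring.
apply: ler_sum => e _; rewrite Egen_sum mulr_sumr.
apply: (@le_trans _ _ (\sum_(f in [set f in H | inc f e.1]) moment_bound g / (g - 1))).
  by apply: ler_sum => f; rewrite inE => /andP[fH _]; apply: lost_edge_le.
rewrite sumr_const -[leLHS]mulr_natl; apply: ler_wpM2r => //.
by rewrite ler_nat -(ham_deg e.1 hH).
Qed.

(** A gained edge is a new edge, so the left exponent is at most Z. Only if a gain occurs is x = b^Z
    replaced by a x^2 + 1/(4a); [a] balances the moment at b^2 against the probability of a gain. *)
Lemma gain_moment (b a : R) : (27 <= n)%N -> 1 < b -> b ^+ 10 <= 2 -> 0 < a ->
  E (fun H' => b ^+ #|H' :&: (S :\: H)|) <=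
  1 + a * moment_bound (b ^+ 2) +
  (2 * k%:R * (moment_bound (b ^+ 2) / (b ^+ 2 - 1)) / n%:R) / (4 * a).
Proof.
move=> n27 b1 b10 a0; have b2 : 1 < b ^+ 2 by rewrite expr_gt1 //; lra.
have b5 : (b ^+ 2) ^+ 5 <= 2 by rewrite -exprM.
have pos := @pos_PiH R n n3 H.
have n0 : 0 < n%:R :> R by rewrite ltr0n (leq_trans _ n27).
apply: (@le_trans _ _ (E (fun=> 1) + (a * E (fun H' => (b ^+ 2) ^+ #|H' :\: H|) +
    (4 * a)^-1 * E (fun H' => (H' :&: (S :\: H) != set0)%:R)))).
  rewrite /E -!EgenZ -!EgenD; apply: Egen_mono => // H' _.
  have : b ^+ #|H' :&: (S :\: H)| <= b ^+ #|H' :\: H|.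
    apply: ler_weXn2l; first exact: ltW.
    by apply: subset_leq_card; rewrite setDE setIA -setDE; apply: setSD; apply: subsetIl.
  rewrite -exprM mulnC exprM.
  have y0 : 0 <= b ^+ #|H' :\: H| by apply: exprn_ge0; lra.
  have a4 : 0 <= (4 * a)^-1 by rewrite invr_ge0; lra.
  have [->|_] := eqVneq (H' :&: (S :\: H)) set0.
    move=> _; rewrite cards0 expr0 mulr0 addr0 lerDl.
    by apply: mulr_ge0; [exact: ltW|exact: sqr_ge0].
  move=> le; set x := b ^+ #|_ :&: _| in le *; set y := b ^+ _ in le y0 *.
  have : y <= a * y ^+ 2 + (4 * a)^-1 * 1.
    rewrite -(ler_pM2r (_ : 0 < 4 * a)); last by lra.
    have -> : (a * y ^+ 2 + (4 * a)^-1 * 1) * (4 * a) = 4 * a ^+ 2 * y ^+ 2 + 1.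
      by field; rewrite gt_eqF.
    by have := sqr_ge0 (2 * a * y - 1); nra.
  by rewrite /=; lra.
rewrite /E (Egen1 n3 pos (gstate0 (ltn_trans (ltn0Sn 1) n3))).
rewrite -addrA lerD2l; apply: lerD.
  by apply: ler_wpM2l; [exact: ltW|apply: power_moment => //; exact: ltW].
rewrite mulrC; apply: ler_wpM2r; first by rewrite invr_ge0; lra.
rewrite ler_pdivlMr // mulrC; exact: gain_prob.
Qed.

Let A := [set e | (e \notin H) &&
  [exists u, inc e u && [forall f, (f \in H) && inc f u ==> (f \in S)]]].

(** Without a gain the overlap with [S] can only shrink, and the H-edge displaced at [u] belongs to
    [S]. *)
Lemma good_edges_lost H' : is_ham H' -> H' :&: (S :\: H) = set0 -> H' :&: A != set0 ->
  (#|H' :&: S| < #|H :&: S|)%N.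
Proof.
move=> hH' g0 /set0Pn[e]; rewrite !inE => /and3P[eH' eH /existsP[u /andP[eu /forallP hu]]].
have [f [fH fu fH']] := ham_lost_edge hH' eH' eH eu.
have fS : f \in S by have := hu f; rewrite fH fu.
apply: proper_card; apply/properP; split.
  apply/subsetP => x; rewrite !inE => /andP[xH' xS]; rewrite xS andbT.
  apply: contraT => xH; have : x \in H' :&: (S :\: H) by rewrite !inE xH' xS xH.
  by rewrite g0 inE.
by exists f; rewrite !inE ?fH ?fS // (negbTE fH').
Qed.

Lemma good_edges_weight m B : (48 <= n)%N -> (4 * k ^ 2 <= n)%N -> ((n.+1)./2 <= m)%N ->
  gstate m.+1 B ->
  (24 * n%:R)^-1 * weight (PiH R H) B <= \sum_(e | admissible B e && (e \in A)) ew (PiH R H) e.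
Proof.
move=> n48 kn hm gB; set N := (n%:R : R).
have hN : 48 <= N by rewrite ler_nat.
have Mn : (m.+1 <= n)%N by rewrite -(gstate_card gB) leq_addl.
have c1 := card_admissible gB.
have c2 : (0 < m)%N -> _ := fun h => card_admissible_ge h gB.
(* [D] holds the at most 2k vertices with an H-edge outside [S]. An admissible edge neither in [A]
   nor in H has both ends in [D], so at most n + 4k^2 <= 2n of the at least n^2/8 admissible edges
   are outside [A]. *)
have cA : (n ^ 2 <= 16 * #|[set e | admissible B e && (e \in A)]|)%N.
  pose D := [set u | ~~ [forall f, (f \in H) && inc f u ==> (f \in S)]].
  have cD : (#|D| <= 2 * k)%N.
    have : D \subset [set f.1 | f in H :\: S] :|: [set f.2 | f in H :\: S].
      apply/subsetP => u; rewrite inE => /forallPn[f]; rewrite negb_imply => /andP[/andP[fH fu] fS].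
      rewrite in_setU; case/orP: fu => /eqP <-; apply/orP; [left|right]; apply/imsetP;
      by exists f; rewrite ?in_setD ?fS.
    move/subset_leq_card/leq_trans; apply; apply: leq_trans (leq_card_setU _ _) _.
    by rewrite mul2n -addnn /k -ham_diff_card // leq_add // leq_imset_card.
  have : [set e | admissible B e] \subset [set e | admissible B e && (e \in A)] :|: (H :|: setX D D).
    apply/subsetP => e; rewrite !inE => ae; rewrite ae /=.
    case: (e \in H) => //=; rewrite ?orbT //.
    case: (boolP [exists u, _]) => //= /existsPn h.
    have h1 := h e.1; have h2 := h e.2; move: h1 h2; rewrite /inc !eqxx orbT /=.
    by move=> -> ->.
  move/subset_leq_card; have := (leq_card_setU [set e | admissible B e && (e \in A)] (H :|: setX D D)).1.
  have := (leq_card_setU H (setX D D)).1; rewrite cardsX (ham_card hH).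
  have : (#|D| * #|D| <= 4 * k ^ 2)%N by apply: leq_trans (leq_mul cD cD) _; rewrite mulnACA.
  have nm : (n <= 2 * m)%N by lia.
  have /c2 : (0 < m)%N by lia.
  have : (n ^ 2 <= 4 * (m.+1 * m))%N by nia.
  have : (48 * n <= n ^ 2)%N by nia.
  move: kn; move: (k ^ 2)%N (n ^ 2)%N (#|D| * #|D|)%N (m.+1 * m)%N => k2 n2 d2 m2.
  move: #|_ :|: (_ :|: _)| #|_ :|: _| #|[set e | admissible B e]| #|[set e | _ && _]|; clear; lia.
have WA : #|[set e | admissible B e && (e \in A)]|%:R * (2 / (N * (N - 2))) <=
    \sum_(e | admissible B e && (e \in A)) ew (PiH R H) e.
  rewrite -sum1_card natr_sum mulr_suml.
  rewrite (eq_bigl (fun e => admissible B e && (e \in A))); last by move=> e; rewrite inE.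
  apply: ler_sum => e /andP[/and4P[lt _ _ _]]; rewrite inE => /andP[/negbTE eH _].
  by rewrite ew_PiH // eH [leLHS]mul1r.
have W : weight (PiH R H) B <= n%:R * 2 + (4 * m.+1 ^ 2)%:R * (2 / (N * (N - 2))).
  apply: (@le_trans _ _ (\sum_(e in H) 2 + \sum_(e | admissible B e) (2 / (N * (N - 2))))).
    rewrite /weight big_mkcond [X in _ <= X + _]big_mkcond [X in _ <= _ + X]big_mkcond -big_split /=.
    apply: ler_sum => e _; case: ifP => ae; last by rewrite addr0; case: ifP.
    case/and4P: ae => lt _ _ _; rewrite ew_PiH //.
    have q0 : 0 <= 2 / (N * (N - 2)) by rewrite divr_ge0 // mulr_ge0; lra.
    case: ifP => _; last by rewrite add0r.
    have : 0 <= 1 / N by rewrite divr_ge0 //; lra.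
    by rewrite -/N; lra.
  rewrite !sumr_const (ham_card hH) -[2 *+ n]mulr_natl lerD2l.
  rewrite -[leLHS]mulr_natl; apply: ler_wpM2r.
    by rewrite divr_ge0 // mulr_ge0; lra.
  by rewrite ler_nat -cardsE.
apply: le_trans WA; rewrite mulrC ler_pdivrMr; last by lra.
apply: le_trans W _.
have M2 : (4 * m.+1 ^ 2)%:R <= 4 * N ^+ 2 :> R.
  by rewrite -natrX -(natrM _ 4) ler_nat leq_mul2l leq_exp2r.
have A2 : N ^+ 2 <= 16 * #|[set e | admissible B e && (e \in A)]|%:R.
  by rewrite -natrX -(natrM _ 16) ler_nat.
move: A2 M2; set cc := #|_|%:R; set mm := (_ * _ ^ _)%:R => A2 M2.
(* The edges in [A] weigh at least N^2 d/16 >= 1/8, all admissible edges at most 2N + 16 <= 3N;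
   hence the constant 24. *)
set d := 2 / (N * (N - 2)).
have d0 : 0 <= d by rewrite divr_ge0 // mulr_ge0; lra.
have hd : d * (N * (N - 2)) = 2 by rewrite divfK // gt_eqF // mulr_gt0; lra.
have u2 : 2 <= N ^+ 2 * d by nra.
have u4 : N ^+ 2 * d <= 4 by nra.
have h1 : mm * d <= 4 * (N ^+ 2 * d) by rewrite mulrA; apply: ler_wpM2r.
have h2 : N ^+ 2 * d <= 16 * (cc * d) by rewrite mulrA; apply: ler_wpM2r.
rewrite -/N; have : 8^-1 * N <= (cc * d) * N by apply: ler_wpM2r; lra.
lra.
Qed.

(** A tour with an edge in [A] and no gain is a loss. At least n/3 picks hit [A] with probability q
    = 1/(24n) or more, so [A] is avoided with probability at most 1/(1 + 1/72) = 72/73. *)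
Lemma loss_prob : (48 <= n)%N -> (4 * k ^ 2 <= n)%N ->
  73^-1 - E (fun H' => (H' :&: (S :\: H) != set0)%:R) <=
  E (fun H' => (#|H' :&: S| < #|H :&: S|)%N%:R).
Proof.
move=> n48 kn; have pos := @pos_PiH R n n3 H.
have g0 : gstate n (set0 : edges) by apply: gstate0; lia.
have hN : 48 <= n%:R :> R by rewrite ler_nat.
set q : R := (24 * n%:R)^-1.
have q0 : 0 <= q by rewrite invr_ge0; lra.
have qN : q * n%:R = 24^-1.
  by rewrite /q invfM -mulrA mulVf ?mulr1 // gt_eqF; lra.
have q1 : q <= 1 by nra.
have := Egen_power_le n3 pos (A := A) (x := 0) (q := q) (m0 := (n.+1)./2) _ _ _ g0.
rewrite lexx ler01 q0 q1 set0I cards0 expr0 mul1r subr0 mul1r.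
move=> /(_ isT isT) h; have {h} h := h (fun m B hm gB => good_edges_weight n48 kn hm gB).
set j := (n - _)%N in h.
have jn : n%:R <= 3 * j%:R :> R by rewrite -(natrM _ 3) ler_nat /j; lia.
have B := @bernoulli_le R q j; rewrite q0 q1 in B; have {}B := B isT.
have jq : 72^-1 <= j%:R * q by nra.
have X0 : 0 <= (1 - q) ^+ j by apply: exprn_ge0; lra.
have X1 : (1 - q) ^+ j <= 72 / 73 by nra.
rewrite lerBlDr.
have : E (fun=> 1) <= E (fun H' => (#|H' :&: S| < #|H :&: S|)%N%:R +
   ((H' :&: (S :\: H) != set0)%:R + 0 ^+ #|H' :&: A|)).
  apply: Egen_mono => // H' hH'; have [g|_] := eqVneq (H' :&: (S :\: H)) set0; last first.
    by rewrite addrCA lerDl addr_ge0 ?exprn_ge0.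
  have [->|a] := eqVneq (H' :&: A) set0.
    by rewrite cards0 expr0 addrA lerDr addr_ge0.
  by rewrite (good_edges_lost hH' g a) lerDl addr_ge0 ?exprn_ge0.
by rewrite -/E in h; rewrite /E !EgenD Egen1 // -/E; lra.
Qed.

End OneSample.

(** * Drift of the potential *)

Lemma sum_tuple_prod (R : comPzRingType) (T : finType) N (g : 'I_N -> T -> R) :
  \sum_(s : N.-tuple T) \prod_i g i (tnth s i) = \prod_i \sum_x g i x.
Proof.
rewrite bigA_distr_bigA /= (reindex (fun f : {ffun 'I_N -> T} => [tuple f i | i < N])) /=.
  by apply: eq_bigr => f _; apply: eq_bigr => i _; rewrite tnth_mktuple.
apply: onW_bij; exists (fun s : N.-tuple T => [ffun i => tnth s i]) => [f|s].
  by apply/ffunP => i; rewrite ffunE tnth_mktuple.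
by apply: eq_from_tnth => i; rewrite tnth_mktuple ffunE.
Qed.

Lemma sstar_ham n : (2 < n)%N -> is_ham (sstar n).
Proof.
move=> n3; apply/hamP; split=> //; exists [ffun i => i]; split=> [i j|]; rewrite ?ffunE //.
by apply: eq_imset => i; rewrite !ffunE.
Qed.

Section Iteration.
Variables (R : realType) (n N : nat).
Hypothesis n3 : (2 < n)%N.
Local Notation edges := {set 'I_n * 'I_n}.
Local Notation S := (sstar n).
Variable sel : nat -> N.-tuple edges -> edges.
Hypothesis best : best_selector sel.
Implicit Types (pi : 'I_n -> 'I_n -> R) (Phi : edges -> R) (Psi : N.-tuple edges -> R).

Definition Ksum t pi Phi := \sum_H kernel sel t pi H * Phi H.

Definition Esamples pi Psi := \sum_(s : N.-tuple edges) (\prod_i gen pi (tnth s i)) * Psi s.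

Lemma KsumE t pi Phi : Ksum t pi Phi = Esamples pi (fun s => Phi (sel t s)).
Proof.
rewrite /Ksum /kernel; under eq_bigr do rewrite mulr_suml.
rewrite exchange_big; apply: eq_bigr => s _ /=.
rewrite (bigD1 (sel t s)) //= eqxx mul1r [X in _ + X]big1 ?addr0 ?big_tuple // => H nH.
by rewrite eq_sym (negbTE nH) !mul0r.
Qed.

Lemma EsamplesD pi Psi Psi' :
  Esamples pi (fun s => Psi s + Psi' s) = Esamples pi Psi + Esamples pi Psi'.
Proof. by rewrite -big_split; apply: eq_bigr => s _; rewrite mulrDr. Qed.

Lemma EsamplesZ pi Psi (a : R) : Esamples pi (fun s => a * Psi s) = a * Esamples pi Psi.
Proof. by rewrite mulr_sumr; apply: eq_bigr => s _; rewrite mulrCA. Qed.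

Lemma Esamples_prod pi (g : 'I_N -> edges -> R) :
  Esamples pi (fun s => \prod_i g i (tnth s i)) = \prod_i Egen pi n set0 (g i).
Proof.
rewrite -(sum_tuple_prod (fun i H => gen pi H * g i H)); apply: eq_bigr => s _.
by rewrite -big_split.
Qed.

Section Pos.
Variable pi : 'I_n -> 'I_n -> R.
Hypothesis pos : positive_weights pi.

Lemma gstate_init : gstate n (set0 : edges).
Proof. by apply: gstate0; lia. Qed.

Lemma Esamples_mono Psi Psi' : (forall s, (forall i, is_ham (tnth s i)) -> Psi s <= Psi' s) ->
  Esamples pi Psi <= Esamples pi Psi'.
Proof.
move=> le; apply: ler_sum => s _.
have [/forallP h|/forallPn[i hi]] := boolP [forall i, is_ham (tnth s i)].
  apply: ler_wpM2l; last exact: le.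
  by apply: prodr_ge0 => i _; apply: genP_ge0.
by rewrite (bigD1 i) //= /gen genP_nham // !mul0r.
Qed.

Lemma Esamples1 : Esamples pi (fun=> 1) = 1.
Proof.
transitivity (Esamples pi (fun s => \prod_(i < N) (fun _ _ => 1 : R) i (tnth s i))).
  by apply: eq_bigr => s _; congr (_ * _); rewrite big1.
by rewrite (Esamples_prod pi (fun _ _ => 1)) big1 // => i _; rewrite Egen1 //; apply: gstate_init.
Qed.

Lemma Esamples_sum (g : edges -> R) :
  Esamples pi (fun s => \sum_i g (tnth s i)) = N%:R * Egen pi n set0 g.
Proof.
have one j : Esamples pi (fun s => g (tnth s j)) = Egen pi n set0 g.
  transitivity (Esamples pi (fun s => \prod_i (fun i H => if i == j then g H else 1) i (tnth s i))).
    apply: eq_bigr => s _; congr (_ * _).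
    by rewrite (bigD1 j) //= eqxx big1 ?mulr1 // => i /negbTE ->.
  rewrite (Esamples_prod pi (fun i H => if i == j then g H else 1)) (bigD1 j) //= eqxx.
  rewrite big1 ?mulr1 // => i /negbTE ->; rewrite Egen1 //; exact: gstate_init.
rewrite -[N in RHS]card_ord mulr_natl -sumr_const -(eq_bigr _ (fun j _ => one j)).
by rewrite exchange_big; apply: eq_bigr => s _; rewrite mulr_sumr.
Qed.

Lemma kernel_ge0 t H : 0 <= kernel sel t pi H.
Proof.
apply: sumr_ge0 => s _; apply: mulr_ge0 => //; rewrite big_tuple.
by apply: prodr_ge0 => i _; apply: genP_ge0.
Qed.

Lemma kernel_sum t : \sum_H kernel sel t pi H = 1.
Proof.
have := KsumE t pi (fun=> 1); rewrite Esamples1 => <-.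
by apply: eq_bigr => H _; rewrite mulr1.
Qed.

Lemma kernel_nham t H : ~~ is_ham H -> kernel sel t pi H = 0.
Proof.
move=> nH; rewrite /kernel big1 // => s _; case: eqP => [e|_]; last by rewrite mul0r.
have [+ _] := best t s; rewrite e => /tnthP[i hi].
by rewrite big_tuple (bigD1 i) //= -hi /gen genP_nham // mul0r mulr0.
Qed.
End Pos.

(** Hitting bound under additive drift: reaching s* costs potential 1, so its probability is at most
    the mean potential after the first selection plus [delta] for each further iteration. *)
Lemma avoid_ge Phi (delta : R) : (forall H, 0 <= Phi H) -> Phi S = 1 -> 0 <= delta ->
  (forall t H, is_ham H -> Ksum t (PiH R H) Phi <= Phi H + delta) ->
  forall k t pi, positive_weights pi -> 1 - avoid sel k t pi <= Ksum t pi Phi + k%:R * delta.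
Proof.
move=> Phi0 PhiS d0 potential_drift; elim=> [|k IH] t pi pos /=.
  rewrite mul0r addr0 lerBlDr -(kernel_sum pos t) /Ksum (bigD1 S) //= [in leRHS](bigD1 S) //= PhiS.
  rewrite mulr1 -addrA lerD2l lerDr.
  by apply: sumr_ge0 => H _; apply: mulr_ge0 => //; apply: kernel_ge0.
set D := k.+1%:R * delta; have D0 : 0 <= D by apply: mulr_ge0.
rewrite lerBlDr; apply: (@le_trans _ _ (\sum_H (kernel sel t pi H * Phi H + kernel sel t pi H * D +
    (if H != S then kernel sel t pi H * avoid sel k t.+1 (PiH R H) else 0)))); last first.
  by rewrite !big_split /= -mulr_suml kernel_sum // mul1r -big_mkcond.
rewrite -(kernel_sum pos t); apply: ler_sum => H _; have k0 := kernel_ge0 pos t H.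
have [->|_] /= := eqVneq H S; first by rewrite PhiS mulr1 addr0 lerDl mulr_ge0 ?kernel_ge0.
have [hH|nH] := boolP (is_ham H); last by rewrite kernel_nham // !mul0r !addr0.
rewrite -!mulrDr -[leLHS]mulr1; apply: ler_wpM2l => //.
have := IH t.+1 (PiH R H) (pos_PiH R n3 H); have := potential_drift t.+1 H hH.
rewrite /D -natr1; lra.
Qed.

Variables (b : R) (K : nat).
Hypothesis b1 : 1 < b.

Definition potential H := b^-1 ^+ minn #|S :\: H| K.

Lemma invb_ge0 : 0 <= b^-1. Proof. by rewrite invr_ge0 ltW ?(lt_trans ltr01). Qed.
Lemma invb_le1 : b^-1 <= 1. Proof. by rewrite invf_le1 ?ltW // (lt_trans ltr01). Qed.

Lemma potential_ge0 H : 0 <= potential H.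
Proof. exact/exprn_ge0/invb_ge0. Qed.

Lemma potential_gain H H' :
  potential H' <= potential H * b ^+ #|H' :&: (S :\: H)|.
Proof.
set G := #|_ :&: _|.
have leG : (#|S :\: H| <= #|S :\: H'| + G)%N.
  rewrite -(cardsID H' (S :\: H)) setIC addnC leq_add2r; apply: subset_leq_card.
  by apply: setSD; apply: subsetDl.
have b0 : 0 < b := lt_trans ltr01 b1.
have -> : potential H * b ^+ G = b^-1 ^+ minn #|S :\: H| K * b ^+ G by [].
apply: (@le_trans _ _ (b^-1 ^+ minn #|S :\: H'| K * b^-1 ^+ G * b ^+ G)).
  by rewrite -mulrA -exprMn mulVf ?gt_eqF // expr1n mulr1.
apply: ler_wpM2r; first exact/exprn_ge0/ltW.
rewrite -exprD; apply: ler_wiXn2l; rewrite ?invb_ge0 ?invb_le1 //; lia.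
Qed.

Lemma sel_sample t (s : N.-tuple edges) : exists i, sel t s = tnth s i.
Proof. by have [/tnthP[i ->] _] := best t s; exists i. Qed.

Lemma overlap_missing H : is_ham H -> (#|H :&: S| + #|S :\: H| = n)%N.
Proof. by move=> hH; have := cardsID H S; rewrite (ham_card (sstar_ham n3)) setIC. Qed.

(** If every sample loses, so does the selected one, and below the cap this gains a full factor
    [b^-1]. Otherwise its gain factor is bounded through the sum over all samples, whichever is
    selected. *)
Lemma potential_sel t (H : edges) (s : N.-tuple edges) : is_ham H -> (forall i, is_ham (tnth s i)) ->
  (#|S :\: H| < K)%N ->
  potential (sel t s) <= potential H *
   (1 + (- (1 - b^-1) * \prod_i (#|tnth s i :&: S| < #|H :&: S|)%N%:R
         + \sum_i (b ^+ #|tnth s i :&: (S :\: H)| - 1))).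
Proof.
move=> hH hs ltK.
have G0 i : 0 <= b ^+ #|tnth s i :&: (S :\: H)| - 1.
  by rewrite subr_ge0; apply: exprn_ege1; exact: ltW.
have [j ej] := sel_sample t s.
have [/forallP h|/forallPn[i hi]] := boolP [forall i, (#|tnth s i :&: S| < #|H :&: S|)%N].
  rewrite big1 => [|i _]; last by rewrite h.
  apply: (@le_trans _ _ (potential H * b^-1)); last first.
    apply: ler_wpM2l; first exact: potential_ge0.
    have : 0 <= \sum_i (b ^+ #|tnth s i :&: (S :\: H)| - 1) by apply: sumr_ge0.
    lra.
  rewrite /potential -exprSr; apply: ler_wiXn2l; rewrite ?invb_ge0 ?invb_le1 //.
  have := overlap_missing hH; have := overlap_missing (hs j).
  have := h j; rewrite -ej; lia.
rewrite [\prod_i _](bigD1 i) //= (negbTE hi) mul0r mulr0 add0r.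
apply: le_trans (potential_gain H _) _; apply: ler_wpM2l; first exact: potential_ge0.
rewrite ej (bigD1 j) //= addrA [1 + _]addrC subrK lerDl; exact: sumr_ge0.
Qed.

Hypotheses (n48 : (48 <= n)%N) (b10 : b ^+ 10 <= 2) (Kn : (4 * K ^ 2 <= n)%N).
Variable a : R.
Hypothesis a0 : 0 < a.
Let max_gain : R := 2 * K%:R * (moment_bound (b ^+ 2) / (b ^+ 2 - 1)) / n%:R.
(** By [loss_prob] this leaves each sample a loss probability of at least 1/100. *)
Hypothesis gain_small : max_gain <= 73^-1 - 100^-1.
Hypothesis weak_gain :
  N%:R * (a * moment_bound (b ^+ 2) + max_gain / (4 * a)) <= (1 - b^-1) * 100^-1 ^+ N.

Lemma natr_ge48 : 48 <= n%:R :> R. Proof. by rewrite ler_nat. Qed.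

Let gain_bound (k : nat) : R := 2 * k%:R * (moment_bound (b ^+ 2) / (b ^+ 2 - 1)) / n%:R.

Lemma gain_bound_mono k : (k <= K)%N -> gain_bound k <= max_gain.
Proof.
move=> le; rewrite /gain_bound /max_gain -!mulrA; apply: ler_wpM2l => //; apply: ler_wpM2r; last by rewrite ler_nat.
have hb := b1; have b2 : 1 < b ^+ 2 by rewrite expr_gt1 //; lra.
rewrite !mulr_ge0 ?expR_ge0 ?invr_ge0 ?ler0n //; lra.
Qed.

(** Below the cap, [weak_gain] makes the joint loss outweigh the gains. At the cap the potential is
    [b^-1 ^+ K], and one iteration multiplies it by at most b^Z for the selected sample, hence by at
    most the sum over all samples. *)
Lemma potential_drift t H : is_ham H ->
  Ksum t (PiH R H) potential <= potential H + N%:R * moment_bound b * b^-1 ^+ K.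
Proof.
move=> hH; have pos := pos_PiH R n3 H; have hS := sstar_ham n3.
have n27 : (27 <= n)%N by lia.
have nN := natr_ge48; have hb := b1; have ha := a0; have hc := gain_small; have hw := weak_gain.
have b2 : 1 < b ^+ 2 by rewrite expr_gt1 //; lra.
have b5 : (b ^+ 2) ^+ 5 <= 2 by rewrite -exprM.
have mb (g : R) : 0 <= g -> 0 <= moment_bound g by move=> g0; rewrite mulr_ge0 ?expR_ge0.
rewrite KsumE; have [ltK|geK] := ltnP #|S :\: H| K.
  apply: (@le_trans _ _ (potential H)); last first.
    rewrite lerDl; apply: mulr_ge0; last exact/exprn_ge0/invb_ge0.
    by apply: mulr_ge0 => //; apply: mb; lra.
  apply: le_trans (Esamples_mono pos (fun s hs => potential_sel t hH hs ltK)) _.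
  rewrite EsamplesZ -[leRHS]mulr1; apply: ler_wpM2l; first exact: potential_ge0.
  rewrite !EsamplesD Esamples1 // EsamplesZ.
  rewrite (Esamples_prod _ (fun _ H' => (#|H' :&: S| < #|H :&: S|)%N%:R)) prodr_const card_ord.
  rewrite (Esamples_sum pos (fun H' => b ^+ #|H' :&: (S :\: H)| - 1)).
  set p := Egen _ _ _ _; set mu := Egen _ _ _ _.
  have cle : gain_bound #|S :\: H| <= max_gain by apply: gain_bound_mono; exact: ltnW.
  have hp : 100^-1 <= p.
    have k2 : (4 * #|S :\: H| ^ 2 <= n)%N.
      by apply: leq_trans Kn; rewrite leq_mul2l leq_exp2r // ltnW.
    have := loss_prob R n3 hH hS n48 k2; have := gain_prob n3 S hH n27 b2 b5.
    rewrite -/p; set q := Egen _ _ _ _ => h1.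
    have : q <= gain_bound #|S :\: H| by rewrite /gain_bound ler_pdivlMr 1?mulrC //; lra.
    by lra.
  have hmu : mu <= a * moment_bound (b ^+ 2) + max_gain / (4 * a).
    have := gain_moment n3 S hH n27 b1 b10 a0; rewrite -/(gain_bound _).
    have -> : mu = Egen (PiH R H) n set0 (fun H' => b ^+ #|H' :&: (S :\: H)|) - 1.
      rewrite /mu (EgenD _ _ _ _ (fun=> -1)); congr (_ + _).
      transitivity (Egen (PiH R H) n set0 (fun=> -1 * 1)); first by apply: eq_bigr => ? _; rewrite mulr1.
      by rewrite EgenZ Egen1 // ?mulr1 //; apply: gstate_init.
    have : gain_bound #|S :\: H| / (4 * a) <= max_gain / (4 * a).
      by apply: ler_wpM2r => //; rewrite invr_ge0; lra.
    lra.
  have pN : 100^-1 ^+ N <= p ^+ N by apply: lerXn2r; rewrite ?nnegrE //; lra.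
  have : N%:R * mu <= N%:R * (a * moment_bound (b ^+ 2) + max_gain / (4 * a)) by apply: ler_wpM2l.
  have := invb_le1; nra.
apply: (@le_trans _ _ (Esamples (PiH R H) (fun s => \sum_i b^-1 ^+ K * b ^+ #|tnth s i :\: H|))).
  apply: Esamples_mono => // s hs; have [j ->] := sel_sample t s.
  rewrite (bigD1 j) //=; apply: (@le_trans _ _ (b^-1 ^+ K * b ^+ #|tnth s j :\: H|)); last first.
    by rewrite lerDl; apply: sumr_ge0 => i _; rewrite mulr_ge0 ?exprn_ge0 ?invb_ge0 //; lra.
  apply: le_trans (potential_gain H _) _; rewrite /potential (minn_idPr geK).
  apply: ler_wpM2l; first exact/exprn_ge0/invb_ge0.
  apply: ler_weXn2l; first exact: ltW.
  by apply: subset_leq_card; rewrite setDE setIA -setDE; apply: setSD; apply: subsetIl.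
rewrite (Esamples_sum pos (fun H' => b^-1 ^+ K * b ^+ #|H' :\: H|)) EgenZ.
apply: (@le_trans _ _ (N%:R * moment_bound b * b^-1 ^+ K)); last first.
  by rewrite lerDr potential_ge0.
rewrite -mulrA; apply: ler_wpM2l => //; rewrite mulrC; apply: ler_wpM2r.
  exact/exprn_ge0/invb_ge0.
apply: power_moment => //; first exact: ltW.
apply: le_trans b10; apply: ler_weXn2l => //; exact: ltW.
Qed.

(** The cap is removed by b^-min(k,K) <= b^-k + b^-K, and the first term is handled by
    [first_sample]. *)
Lemma potential_start t : Ksum t (Pi0 R n) potential <=
  N%:R * ((1 - (1 - b^-1) / 2) ^+ (n - (n.+1)./2) + b^-1 ^+ K).
Proof.
have pos := pos_Pi0 R n3; have hS := sstar_ham n3.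
rewrite KsumE; apply: (@le_trans _ _ (Esamples (Pi0 R n)
   (fun s => \sum_i (b^-1 ^+ #|tnth s i :\: S| + b^-1 ^+ K)))).
  apply: Esamples_mono => // s hs; have [j ->] := sel_sample t s.
  have e0 m : 0 <= b^-1 ^+ m by apply/exprn_ge0/invb_ge0.
  rewrite (bigD1 j) //= (ham_diff_card (hs j) hS) /potential.
  have : 0 <= \sum_(i | i != j) (b^-1 ^+ #|tnth s i :\: S| + b^-1 ^+ K).
    by apply: sumr_ge0 => i _; rewrite addr_ge0.
  have := e0 K; have := e0 #|S :\: tnth s j|.
  by case: leqP => _; lra.
rewrite (Esamples_sum pos (fun H' => b^-1 ^+ #|H' :\: S| + b^-1 ^+ K)) EgenD.
apply: ler_wpM2l => //; apply: lerD; first by apply: (first_sample n3 hS n48); apply/andP; split; [exact: invb_ge0|exact: invb_le1].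
have -> : Egen (Pi0 R n) n set0 (fun=> b^-1 ^+ K) = Egen (Pi0 R n) n set0 (fun=> b^-1 ^+ K * 1).
  by apply: eq_bigr => ? _; rewrite mulr1.
by rewrite EgenZ Egen1 ?mulr1 //; apply: gstate_init.
Qed.

Lemma not_found_ge T : 1 - prob_not_found R sel T <=
  N%:R * ((1 - (1 - b^-1) / 2) ^+ (n - (n.+1)./2) + b^-1 ^+ K) +
  T%:R * (N%:R * moment_bound b * b^-1 ^+ K).
Proof.
apply: (@le_trans _ _ (Ksum 0 (Pi0 R n) potential + T%:R * (N%:R * moment_bound b * b^-1 ^+ K))); last first.
  by rewrite lerD2r; exact: potential_start.
apply: avoid_ge; [exact: potential_ge0| | |exact: potential_drift|exact: pos_Pi0].
  by rewrite /potential setDv cards0 min0n expr0.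
by have hb := b1; rewrite !mulr_ge0 ?expR_ge0 ?exprn_ge0 ?invb_ge0 //; lra.
Qed.
End Iteration.

(** * Asymptotics *)

Section Asymptotics.
Variable R : realType.

Lemma root_pow (x : R) : 0 <= x -> (x `^ (1 / 10)) ^+ 10 = x.
Proof.
move=> x0; rewrite -powR_mulrn ?powR_ge0 // -powRrM (_ : 1 / 10 * 10%:R = 1) ?powRr1 //.
by lra.
Qed.

(** The generous 22 is 220/10, so that N < ln n / 220 yields 100^N <= n^(1/10). *)
Lemma pow100_le_expR (N : nat) : 100 ^+ N <= expR (22 * N%:R) :> R.
Proof.
rewrite mulrC expRM_natl; apply: lerXn2r; rewrite ?nnegrE ?expR_ge0 //.
have e2 : 2 <= expR 1 :> R by have := expR_ge1Dx (1 : R); lra.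
rewrite -[22 in leRHS]mulr1 expRM_natl; apply: (@le_trans _ _ (2 ^+ 22)).
  by rewrite -natrX ler_nat.
by apply: lerXn2r; rewrite ?nnegrE ?expR_ge0.
Qed.

Lemma pow_le_expR (x : R) k : 0 <= x <= 1 -> (1 - x) ^+ k <= expR (- (k%:R * x)).
Proof.
move=> /andP[x0 x1]; rewrite -mulrN expRM_natl; apply: lerXn2r; rewrite ?nnegrE ?expR_ge0 //.
  lra.
by have := expR_ge1Dx (- x); lra.
Qed.

Lemma third_le_half (n : nat) : (48 <= n)%N -> n%:R <= 3 * (n - n.+1./2)%N%:R :> R.
Proof. by move=> n_ge48; rewrite -(natrM _ 3) ler_nat; lia. Qed.

Variable b : R.
Hypotheses (b_gt1 : 1 < b) (b10_le2 : b ^+ 10 <= 2) (b_inv : b^-1 = 20 / 21).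
Let C0 : R := moment_bound b.
Let C1 : R := moment_bound (b ^+ 2).
Let C2 : R := moment_bound (b ^+ 2) / (b ^+ 2 - 1).
(** The term 600 [C2] ensures 2 [C2] <= (1/73 - 1/100) y^8, 21([C1] + [C2]) makes gains smaller than
    1 - 1/b = 1/21 relative to y^-1, and [C0] gives 2 + [C0] <= e^y. *)
Definition threshold : R := 1000 + 600 * C2 + 21 * (C1 + C2) + C0.
Let Y := threshold.

Lemma b_ge0 : 0 <= b. Proof. exact/ltW/(lt_trans ltr01). Qed.
Lemma C0_ge0 : 0 <= C0. Proof. by rewrite mulr_ge0 ?expR_ge0 ?b_ge0. Qed.
Lemma C1_ge0 : 0 <= C1. Proof. by rewrite mulr_ge0 ?expR_ge0 // exprn_ge0 // b_ge0. Qed.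
Lemma C2_ge0 : 0 <= C2.
Proof. by rewrite divr_ge0 ?C1_ge0 // subr_ge0 exprn_ege1 //; exact/ltW. Qed.

Section Large.
Variables (n N : nat).
Let y : R := n%:R `^ (1 / 10).
Hypotheses (hY : Y <= y) (hN : N%:R < ln (n%:R : R) / 220).

Lemma y_ge1000 : 1000 <= y.
Proof.
have := hY; rewrite /Y /threshold; have := C0_ge0; have := C1_ge0; have := C2_ge0; lra.
Qed.

Lemma y_pow : y ^+ 10 = n%:R. Proof. exact: root_pow. Qed.

Lemma y_exp : y = expR (ln (n%:R : R) / 10).
Proof.
have y0 := y_ge1000; rewrite /y /powR; case: eqP => [e|_]; last by rewrite mulrC mul1r.
by have := y_pow; rewrite e => /eqP; rewrite expf_eq0 /= => /eqP e'; move: y0; rewrite e'; lra.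
Qed.

Lemma N_le_y : N%:R <= y.
Proof.
have := expR_ge1Dx (ln (n%:R : R) / 10); rewrite -y_exp; have := hN; have := y_ge1000; lra.
Qed.

Lemma inv_y_le : y^-1 <= 100^-1 ^+ N.
Proof.
have y0 := y_ge1000; rewrite exprVn lef_pV2 ?posrE ?exprn_gt0 //; last by lra.
apply: le_trans (pow100_le_expR N) _; rewrite y_exp ler_expR; have := hN; lra.
Qed.

Lemma n_le_y_pow k : (k <= 10)%N -> y ^+ k <= n%:R.
Proof.
by move=> k10; rewrite -y_pow; apply: ler_weXn2l => //; have := y_ge1000; lra.
Qed.

Lemma n_ge48 : (48 <= n)%N.
Proof.
by rewrite -(ler_nat R); have := n_le_y_pow (isT : 1 <= 10)%N; rewrite expr1; have := y_ge1000; lra.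
Qed.

Let K := Num.truncn (y ^+ 2).

Lemma K_le : K%:R <= y ^+ 2.
Proof. by rewrite truncn_le // exprn_ge0 //; have := y_ge1000; lra. Qed.

Lemma K_gt : y ^+ 2 < K%:R + 1.
Proof. by rewrite natr1 truncnS_gt // exprn_ge0 //; have := y_ge1000; lra. Qed.

Lemma K_sq : (4 * K ^ 2 <= n)%N.
Proof.
rewrite -(ler_nat R) natrM natrX; apply: le_trans (n_le_y_pow (isT : 5 <= 10)%N).
have : K%:R ^+ 2 <= (y ^+ 2) ^+ 2.
  by apply: lerXn2r; rewrite ?nnegrE ?K_le ?sqr_ge0.
rewrite -exprM => h; apply: (@le_trans _ _ (4 * y ^+ (2 * 2))); first by rewrite ler_pM2l.
rewrite [leRHS]exprS; apply: ler_wpM2r; first by rewrite exprn_ge0 //; have := y_ge1000; lra.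
by have := y_ge1000; lra.
Qed.

Lemma gain_bound_le : 2 * K%:R * C2 / n%:R <= 2 * C2 / y ^+ 8.
Proof.
have y0 := y_ge1000; have yp k : 0 < y ^+ k by rewrite exprn_gt0 //; lra.
rewrite -y_pow ler_pdivrMr // (exprD y 8 2 : y ^+ 10 = _).
rewrite [leRHS]mulrA divfK ?gt_eqF //.
by have := ler_wpM2r C2_ge0 K_le; lra.
Qed.

Lemma not_found_small (sel : nat -> N.-tuple {set 'I_n * 'I_n} -> {set 'I_n * 'I_n}) T : best_selector sel -> T%:R <= expR y ->
  1 - prob_not_found R sel T <= expR (- y).
Proof.
move=> best hT; have y0 := y_ge1000; have yp k : 0 < y ^+ k by rewrite exprn_gt0 //; lra.
have n3 : (2 < n)%N by have := n_ge48; lia.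
have c0 := C0_ge0; have c1 := C1_ge0; have c2 := C2_ge0; have hYy := hY.
have y1k k : (0 < k)%N -> y <= y ^+ k by move=> k0; rewrite -[leLHS]expr1; apply: ler_weXn2l => //; lra.
(* The choice a = y^-5: since the gain probability is of order y^-8 and N <= y, the two terms of
   [weak_gain] are of orders y^-4 and y^-2, both below y^-1. *)
have a0 : 0 < (y ^+ 5)^-1 by rewrite invr_gt0.
have Cy8 : 2 * C2 / y ^+ 8 <= 73^-1 - 100^-1.
  rewrite ler_pdivrMr //; have := y1k 8%N isT; move: (y ^+ 8) => z; rewrite /Y /threshold in hYy; lra.
have h1 := le_trans gain_bound_le Cy8.
have h2 : N%:R * ((y ^+ 5)^-1 * C1 + 2 * K%:R * C2 / n%:R / (4 * (y ^+ 5)^-1)) <=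
    (1 - b^-1) * 100^-1 ^+ N.
  apply: (@le_trans _ _ (y * ((y ^+ 5)^-1 * C1 + 2 * C2 / y ^+ 8 / (4 * (y ^+ 5)^-1)))).
    apply: ler_pM => //; last 1 first.
    - by rewrite lerD2l; apply: ler_wpM2r; [rewrite invr_ge0; lra|exact: gain_bound_le].
    - apply: addr_ge0; first by apply: mulr_ge0 => //; exact: ltW.
      apply: divr_ge0; last by apply: mulr_ge0 => //; exact: ltW.
      by apply: divr_ge0 => //; apply: mulr_ge0 => //; apply: mulr_ge0.
    - exact: N_le_y.
  apply: (@le_trans _ _ ((1 - b^-1) * y^-1)); last first.
    by apply: ler_wpM2l; [rewrite b_inv; lra|exact: inv_y_le].
  have -> : y * ((y ^+ 5)^-1 * C1 + 2 * C2 / y ^+ 8 / (4 * (y ^+ 5)^-1)) =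
     (C1 / y ^+ 3 + C2 / 2 / y) * y^-1.
    by field; rewrite gt_eqF //; lra.
  apply: ler_wpM2r; first by rewrite invr_ge0; lra.
  rewrite b_inv; have : C1 / y ^+ 3 <= C1 / y.
    by apply: ler_wpM2l => //; rewrite lef_pV2 ?posrE //; [exact: y1k|lra].
  have : (C1 + C2) / y <= 21^-1.
    rewrite ler_pdivrMr; last by lra.
    by rewrite /Y /threshold in hYy; lra.
  have : 0 <= C2 / y by rewrite divr_ge0 //; lra.
  lra.
apply: le_trans (not_found_ge n3 best b_gt1 n_ge48 b10_le2 K_sq a0 h1 h2 T) _.
move: K K_gt {h1 h2} => k k_gt.
(* Common bound for both powers: 126 = 3 * 42 comes from n/3 early picks of the first sample with
   factor 1 - 1/42 each. *)
have D1 : b^-1 ^+ k <= expR (- ((y ^+ 2 - 1) / 126)).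
  have -> : b^-1 = 1 - 1 / 21 by rewrite b_inv; lra.
  apply: le_trans (pow_le_expR _ _) _; first by lra.
  by rewrite ler_expR; have := y1k 2%N isT; lra.
have D2 : (1 - (1 - b^-1) / 2) ^+ (n - (n.+1)./2) <= expR (- ((y ^+ 2 - 1) / 126)).
  have e42 : (1 - b^-1) / 2 = 1 / 42 by rewrite b_inv; lra.
  rewrite e42; move: (n - _)%N (third_le_half n_ge48) => j hj.
  apply: le_trans (pow_le_expR j _) _; first by lra.
  by rewrite ler_expR; have := n_le_y_pow (isT : 2 <= 10)%N; lra.
set D := expR _ in D1 D2; have D0 : 0 <= D := expR_ge0 _.
have yE : y <= expR y by have := expR_ge1Dx y; lra.
have E0 : 0 < expR y := expR_gt0 _.
have NE : N%:R <= expR y := le_trans N_le_y yE.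
have bK0 : 0 <= b^-1 ^+ k by rewrite exprn_ge0 // b_inv; lra.
have t1 : N%:R * ((1 - (1 - b^-1) / 2) ^+ (n - (n.+1)./2) + b^-1 ^+ k) <= expR y * (2 * D).
  apply: ler_pM => //; last by lra.
  by rewrite addr_ge0 // exprn_ge0 // b_inv; lra.
have t2 : T%:R * (N%:R * C0 * b^-1 ^+ k) <= expR y * (expR y * C0 * D).
  apply: ler_pM => //; first by apply: mulr_ge0 => //; exact: mulr_ge0.
  by apply: ler_pM => //; [exact: mulr_ge0|apply: ler_wpM2r].
have E1 : 2 + C0 <= expR y by rewrite /Y /threshold in hYy; lra.
have E2 : 1 <= expR y by lra.
(* The sample size, the number of iterations and the constants cost one factor e^y each, and (y^2 -
   1)/126 >= 4y because y >= 1000. *)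
apply: (@le_trans _ _ (expR y * expR y * expR y * D)).
  apply: le_trans (lerD t1 t2) _.
  have -> : expR y * (2 * D) + expR y * (expR y * C0 * D) = expR y * D * (2 + expR y * C0) by ring.
  have -> : expR y * expR y * expR y * D = expR y * D * (expR y * expR y) by ring.
  apply: ler_wpM2l; first by rewrite mulr_ge0 // ltW.
  nra.
rewrite /D -!expRD ler_expR; nra.
Qed.
End Large.

Lemma large_root (n : nat) : ((Num.truncn (Y ^+ 10)).+1 <= n)%N -> Y <= n%:R `^ (1 / 10).
Proof.
move=> h; have Y0 : 0 <= Y by rewrite /Y /threshold; have := C0_ge0; have := C1_ge0; have := C2_ge0; lra.
rewrite -(ler_pXn2r (isT : 0 < 10)%N) ?nnegrE ?powR_ge0 // root_pow //.
apply: ltW; apply: lt_le_trans (_ : (Num.truncn (Y ^+ 10)).+1%:R <= _); last by rewrite ler_nat.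
by apply: truncnS_gt; rewrite exprn_ge0.
Qed.

End Asymptotics.

Theorem theorem3 (R : realType) :
  exists (c1 c2 : R), 0 < c1 /\ 0 < c2 /\
  exists n0 : nat, forall (n N : nat), (n0 <= n)%N -> (0 < N)%N ->
    N%:R < ln (n%:R : R) / 220 ->
    forall sel : nat -> N.-tuple {set 'I_n * 'I_n} -> {set 'I_n * 'I_n},
    best_selector sel ->
    forall T : nat, T%:R <= expR (c2 * (n%:R `^ (1 / 300))) ->
      1 - expR (- (c1 * (n%:R `^ (1 / 200)))) <= prob_not_found R sel T.
Proof.
(* The moment bound is used at b^2, whose fifth power must not exceed 2; (21/20)^10 is about
   1.63. *)
pose b : R := 21 / 20.
have b1 : 1 < b by rewrite /b; lra.
have b10 : b ^+ 10 <= 2 by rewrite /b; lra.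
have b_inv : b^-1 = 20 / 21 by rewrite /b invf_div.
move: b b1 b10 b_inv => b b1 b10 b_inv.
(* Both constants can be 1 because the estimates hold with exponent 1/10, which exceeds 1/200 and
   1/300. *)
exists 1, 1; split => //; split => //; exists (Num.truncn (threshold b ^+ 10)).+1.
move=> n N /(large_root b1) hY _ hN sel best T hT.
have n1 : 1 <= n%:R :> R by have := n_ge48 b1 hY; rewrite (ler_nat R 1) => /ltnW; lia.
have mono (u : R) : u <= 1 / 10 -> n%:R `^ u <= n%:R `^ (1 / 10) := @ler_powR R _ n1 _ _.
have hT' : T%:R <= expR (n%:R `^ (1 / 10)) :> R.
  by apply: le_trans hT _; rewrite mul1r ler_expR mono //; lra.
have := not_found_small b1 b10 b_inv hY hN best hT'.
have : expR (- n%:R `^ (1 / 10)) <= expR (- (1 * n%:R `^ (1 / 200))) :> R.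
  by rewrite ler_expR lerN2 [leLHS]mul1r mono //; lra.
lra.
Qed.
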